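(* Let $K$ be a $\Gamma$-invariant $\boldsymbol H$-operator valued kernel on $X$ which is partially positive semidefinite with respect to the partition $P_a=\{X_s\}_{s\in S}$ of $X$. Then there exists a minimal generalised $\Gamma$-invariant Hilbert space linearisation $(\boldsymbol K;\boldsymbol D;\boldsymbol V;\Psi)$ of $K$, with $\boldsymbol K=\{\mathcal K_s\}_{s\in S}$, $\boldsymbol D=\{\mathcal D_s\}_{s\in S}$, $\boldsymbol V=\{V_x\}_{x\in X}$, which is unique modulo unitary equivalence in the following sense: whenever $(\boldsymbol K';\boldsymbol D';\boldsymbol V';\Psi')$ is another minimal generalised $\Gamma$-invariant Hilbert space linearisation of $K$ with $\mathcal D'_s=\operatorname{Lin}\{V'_x\mathcal H_x\mid x\in X_s\}$ for all $s\in S$, there exists a bundle of unitary operators $\boldsymbol U=\{U_s\}_{s\in S}$ such that: (a) $U_s\colon\mathcal K_s\to\mathcal K'_s$ and $U_s\mathcal D_s\subseteq\mathcal D'_s$, for all $s\in S$; (b) $U_{c(\alpha)}\Psi(\alpha)|_{\mathcal D_{d(\alpha)}}=\Psi'(\alpha)U_{d(\alpha)}|_{\mathcal D_{d(\alpha)}}$, for all $\alpha\in\Gamma$; (c) $U_{a(x)}V_x=V'_x$, for all $x\in X$.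
   Context: $\mathbb F$ is $\mathbb R$ or $\mathbb C$. $\operatorname{Lin}$ denotes linear span. $\mathcal B(\mathcal H,\mathcal G)$ is the space of bounded linear operators. Semigroupoids. A semigroupoid $(\Gamma;S;d;c;\cdot)$ consists of nonempty sets $\Gamma$ and $S$ (the set of symbols), maps $d,c\colon\Gamma\to S$ (domain and codomain maps), and a product $\alpha\beta\in\Gamma$ defined whenever $d(\alpha)=c(\beta)$ (the set of such pairs is $\Gamma^{(2)}$), with $d(\alpha\beta)=d(\beta)$, $c(\alpha\beta)=c(\alpha)$, and $\alpha(\beta\gamma)=(\alpha\beta)\gamma$ whenever $d(\alpha)=c(\beta)$, $d(\beta)=c(\gamma)$. Put $\Gamma_s=\{\alpha\mid d(\alpha)=s\}$, $\Gamma^t=\{\alpha\mid c(\alpha)=t\}$, $\Gamma_s^t=\Gamma_s\cap\Gamma^t$. A $*$-semigroupoid is a semigroupoid with a map $\alpha\mapsto\alpha^*$ such that $d(\alpha^* )=c(\alpha)$, $c(\alpha^* )=d(\alpha)$, $(\alpha\beta)^*=\beta^*\alpha^*$ for $(\alpha,\beta)\in\Gamma^{(2)}$, and $(\alpha^* )^*=\alpha$. No unit is assumed. A left action $(a;\cdot)$ of $\Gamma$ on a nonempty set $X$ consists of a surjective map $a\colon X\to S$ (the anchor) and, for each $x\in X$ and $\alpha\in\Gamma_{a(x)}$, an element $\alpha\cdot x\in X$ with $a(\alpha\cdot x)=c(\alpha)$, such that $(\alpha\beta)\cdot x=\alpha\cdot(\beta\cdot x)$ for $(\alpha,\beta)\in\Gamma^{(2)}$,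 $\beta\in\Gamma_{a(x)}$. Setting. $\Gamma$ is a $*$-semigroupoid with symbol set $S$, $(a;\cdot)$ is a left action of $\Gamma$ on the nonempty set $X$, $X_s=a^{-1}(\{s\})$, $P_a=\{X_s\}_{s\in S}$. $\boldsymbol H=\{\mathcal H_x\}_{x\in X}$ is a bundle (family) of Hilbert spaces over $\mathbb F$ such that $\mathcal H_{\alpha\cdot x}=\mathcal H_x$ for all $x\in X$, $\alpha\in\Gamma_{a(x)}$. An $\boldsymbol H$-operator valued kernel $K$ on $X$ is a map on $X\times X$ with $K(x,y)\in\mathcal B(\mathcal H_y,\mathcal H_x)$. $K$ is $\Gamma$-invariant if $K(\alpha\cdot x,y)=K(x,\alpha^*\cdot y)$ for all $x,y\in X$ and $\alpha\in\Gamma_{a(x)}^{a(y)}$. $K$ is partially positive semidefinite with respect to $P_a$ if for every $s\in S$, $K(x,y)^*=K(y,x)$ for $x,y\in X_s$, and $\sum_{i,j=1}^n\langle K(x_j,x_i)h_i,h_j\rangle_{\mathcal H_{x_j}}\ge0$ for all $n\in\mathbb N$, $x_1,\dots,x_n\in X_s$, $h_i\in\mathcal H_{x_i}$. Generalised representations. Let $\boldsymbol K=\{\mathcal K_s\}_{s\in S}$ be Hilbert spaces and $\boldsymbol D=\{\mathcal D_s\}_{s\in S}$ with $\mathcal D_s$ a dense linear subspace of $\mathcal K_s$. $\mathcal L^*(\mathcal D_s,\mathcal D_t)$ is the vector space of linear operators $T\colon\mathcal D_s\to\mathcal K_t$ with $T\mathcal D_s\subseteq\mathcal D_t$, $\mathcal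 D_t\subseteq\operatorname{Dom}(T^* )$ and $T^*\mathcal D_t\subseteq\mathcal D_s$ ($T^*$ the possibly unbounded Hilbert space adjoint). $\Gamma_{\boldsymbol K,\boldsymbol D}=\bigsqcup_{s,t\in S}\mathcal L^*(\mathcal D_s,\mathcal D_t)$ is a $*$-semigroupoid with symbol set $S$ under composition, with involution $T\mapsto T^*|_{\mathcal D_t}$. A generalised $*$-representation $(\mathrm{Id}_S;\Psi)$ of $\Gamma$ on $\Gamma_{\boldsymbol K,\boldsymbol D}$ is a map $\Psi\colon\Gamma\to\Gamma_{\boldsymbol K,\boldsymbol D}$ with $\Psi(\alpha)\in\mathcal L^*(\mathcal D_{d(\alpha)},\mathcal D_{c(\alpha)})$, $\Psi(\alpha\beta)=\Psi(\alpha)\Psi(\beta)$ on $\mathcal D_{d(\beta)}$ for $(\alpha,\beta)\in\Gamma^{(2)}$, and $\Psi(\alpha^* )=\Psi(\alpha)^*$ on $\mathcal D_{c(\alpha)}$. A generalised $\Gamma$-invariant Hilbert space linearisation of $K$ is a quadruple $(\boldsymbol K;\boldsymbol D;\boldsymbol V;\Psi)$ such that: (GIL1) $\boldsymbol K=\{\mathcal K_s\}_{s\in S}$ is a bundle of Hilbert spaces and $\boldsymbol D=\{\mathcal D_s\}_{s\in S}$ a bundle of vector spaces with $\mathcal D_s$ dense in $\mathcal K_s$; (GIL2) $\boldsymbol V=\{V_x\}_{x\in X}$ with $V_x\in\mathcal B(\mathcal H_x,\mathcal K_{a(x)})$ and $K(x,y)=V_x^*V_y$ for all $x,y\in X$ with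 $a(x)=a(y)$; (GIL3) $(\mathrm{Id}_S;\Psi)$ is a generalised $*$-representation of $\Gamma$ on $\Gamma_{\boldsymbol K,\boldsymbol D}$ and $\Psi(\alpha)V_x=V_{\alpha\cdot x}$ for all $x\in X$, $\alpha\in\Gamma_{a(x)}$ (in particular the composition is defined, i.e. $V_x\mathcal H_x\subseteq\mathcal D_{a(x)}$ whenever $\Gamma_{a(x)}\neq\emptyset$). It is minimal if (GIL4) for each $s\in S$, $\mathcal K_s$ is the closed span of $\{V_x\mathcal H_x\mid x\in X,\ a(x)=s\}$. *)

(* Defs.v *)
From HB Require Import structures.
From mathcomp Require Import all_boot all_order all_algebra.
From mathcomp Require Import all_classical all_reals all_analysis.
From mathcomp Require Import complex.

Set Implicit Arguments.
Unset Strict Implicit.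
Unset Printing Implicit Defensive.

Import Order.TTheory GRing.Theory Num.Theory.
Import numFieldNormedType.Exports.

Local Open Scope classical_set_scope.
Local Open Scope ring_scope.

(** * Hilbert spaces over the real or the complex numbers *)

Variant scalar_kind := RealScalars | ComplexScalars.

Definition scalars (R : realType) (k : scalar_kind) : numFieldType :=
  match k with
  | RealScalars => R
  | ComplexScalars => R[i]
  end.

Definition conj_scalar (R : realType) (k : scalar_kind) :
    scalars R k -> scalars R k :=
  match k with
  | RealScalars => id
  | ComplexScalars => @Num.conj R[i]
  end.

(* A form [{dot _ for theta}] is linear in its first argument and
   theta-semilinear in the second. *)
Record hilbert (R : realType) (k : scalar_kind) := Hilbert {
  hilbert_sort :> completeNormedModType (scalars R k);
  inner : {dot hilbert_sort for @conj_scalar R k};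
  innerxx : forall u : hilbert_sort, inner u u = `|u| ^+ 2
}.

Definition subspace_set (F : numFieldType) (V : lmodType F) (D : set V) :=
  D 0 /\ forall (c : F) (u v : V), D u -> D v -> D (c *: u + v).

Definition lin_span (F : numFieldType) (V : lmodType F) (A : set V) : set V :=
  [set v | exists (n : nat) (c : 'I_n -> F) (u : 'I_n -> V),
     (forall i, A (u i)) /\ v = \sum_(i < n) c i *: u i].

Record bounded_op (R : realType) (k : scalar_kind) (E F : hilbert R k) :=
  BoundedOp {
    bounded_op_fun :> {linear E -> F};
    bounded_opP : bounded_near bounded_op_fun (nbhs (0 : E))
  }.

(* [is_adjoint T W] states that T^* = W. *)
Definition is_adjoint (R : realType) (k : scalar_kind) (E F : hilbert R k)
    (T : bounded_op E F) (W : bounded_op F E) :=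
  forall (u : E) (v : F), inner F (T u) v = inner E u (W v).

Definition unitary (R : realType) (k : scalar_kind) (E F : hilbert R k)
    (U : {linear E -> F}) :=
  bijective U /\ forall u v : E, inner F (U u) (U v) = inner E u v.

(* For an operator T with domain D, [adjoint_graph D T w z] states that w lies
   in the domain of T^* and that T^* w = z; z is unique if D is dense. *)
Definition adjoint_graph (R : realType) (k : scalar_kind) (E F : hilbert R k)
    (D : set E) (T : E -> F) (w : F) (z : E) :=
  forall u : E, D u -> inner F (T u) w = inner E u z.

(* The space L^*(D, D').  An operator with domain D is represented by a total
   function, whose values outside D are irrelevant. *)
Record Lstar (R : realType) (k : scalar_kind) (E F : hilbert R k)
    (D : set E) (D' : set F) := LStar {
  Lstar_fun :> E -> F;
  Lstar_linear : forall (c : scalars R k) (u v : E), D u -> D v ->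
    Lstar_fun (c *: u + v) = c *: Lstar_fun u + Lstar_fun v;
  Lstar_maps : forall u, D u -> D' (Lstar_fun u);
  Lstar_adj_dom : forall w, D' w -> exists z, adjoint_graph D Lstar_fun w z;
  Lstar_adj_maps : forall w z, D' w -> adjoint_graph D Lstar_fun w z -> D z
}.

(** * Semigroupoids and their left actions *)

Record semigroupoid := Semigroupoid {
  sgd_sort :> Type;
  symb : Type;
  sgd_inhabited : inhabited sgd_sort;
  symb_inhabited : inhabited symb;
  dom : sgd_sort -> symb;
  cod : sgd_sort -> symb;
  sgd_mul : forall g h : sgd_sort, dom g = cod h -> sgd_sort;
  dom_mul : forall g h (p : dom g = cod h), dom (sgd_mul p) = dom h;
  cod_mul : forall g h (p : dom g = cod h), cod (sgd_mul p) = cod g;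
  sgd_mulA : forall f g h (p : dom f = cod g) (q : dom g = cod h),
    @sgd_mul f (sgd_mul q) (etrans p (esym (cod_mul q))) =
    @sgd_mul (sgd_mul p) h (etrans (dom_mul p) q)
}.

Record star_semigroupoid := StarSemigroupoid {
  star_sgd :> semigroupoid;
  star : star_sgd -> star_sgd;
  dom_star : forall g, dom (star g) = cod g;
  cod_star : forall g, cod (star g) = dom g;
  star_mul : forall g h (p : dom g = cod h),
    star (sgd_mul p) =
    @sgd_mul _ (star h) (star g)
      (etrans (dom_star h) (etrans (esym p) (esym (cod_star g))));
  starK : forall g, star (star g) = g
}.

Record left_action (G : semigroupoid) (X : Type) := LeftAction {
  action_inhabited : inhabited X;
  anchor : X -> symb G;
  anchor_surj : forall s, exists x, anchor x = s;
  act : forall (g : G) (x : X), dom g = anchor x -> X;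
  anchor_act : forall g x (p : dom g = anchor x), anchor (act p) = cod g;
  act_mul : forall (g h : G) x (p : dom g = cod h) (q : dom h = anchor x),
    @act (sgd_mul p) x (etrans (dom_mul p) q) =
    @act g (act q) (etrans p (esym (anchor_act q)))
}.

(** * Bundles and kernels *)

(* The identity map between two Hilbert spaces that are equal, but not
   convertible. *)
Definition transport (R : realType) (k : scalar_kind) (E F : hilbert R k)
    (e : E = F) (v : E) : F :=
  eq_rect E (fun Z : hilbert R k => Z) v F e.

Definition btransport (R : realType) (k : scalar_kind) (I : Type)
    (B : I -> hilbert R k) (i j : I) (e : i = j) (v : B i) : B j :=
  transport (congr1 B e) v.

Definition invariant_bundle (R : realType) (k : scalar_kind)
    (G : semigroupoid) (X : Type) (A : left_action G X)
    (H : X -> hilbert R k) :=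
  forall (g : G) (x : X) (p : dom g = anchor A x), H (act p) = H x.

Definition operator_kernel (R : realType) (k : scalar_kind) (X : Type)
    (H : X -> hilbert R k) :=
  forall x y : X, bounded_op (H y) (H x).

Definition invariant_kernel (R : realType) (k : scalar_kind)
    (G : star_semigroupoid) (X : Type) (A : left_action G X)
    (H : X -> hilbert R k) (eH : invariant_bundle A H) (K : operator_kernel H) :=
  forall (g : G) (x y : X) (p : dom g = anchor A x) (q : cod g = anchor A y),
    let q' : dom (star g) = anchor A y := etrans (dom_star g) q in
    forall u : H y,
      transport (eH g x p) (K (act p) y u) =
      K x (act q') (transport (esym (eH (star g) y q')) u).

Definition partially_psd (R : realType) (k : scalar_kind)
    (G : semigroupoid) (X : Type) (A : left_action G X)
    (H : X -> hilbert R k) (K : operator_kernel H) :=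
  forall s : symb G,
    (forall x y, anchor A x = s -> anchor A y = s ->
       is_adjoint (K x y) (K y x)) /\
    (forall (n : nat) (x : 'I_n -> X) (h : forall i, H (x i)),
       (forall i, anchor A (x i) = s) ->
       0 <= \sum_(i < n) \sum_(j < n)
              inner (H (x j)) (K (x j) (x i) (h i)) (h j)).

(** * Generalised invariant Hilbert space linearisations *)

Record linearisation (R : realType) (k : scalar_kind)
    (G : star_semigroupoid) (X : Type) (A : left_action G X)
    (H : X -> hilbert R k) (eH : invariant_bundle A H) (K : operator_kernel H) :=
  Linearisation {
  lspace : symb G -> hilbert R k;
  ldom : forall s, set (lspace s);
  lV : forall x, bounded_op (H x) (lspace (anchor A x));
  lPsi : forall g : G, Lstar (@ldom (dom g)) (@ldom (cod g));
  ldom_subspace : forall s, subspace_set (@ldom s);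
  ldom_dense : forall s, dense (@ldom s);
  (* K(x, y) = V_x^* V_y *)
  lV_kernel : forall x y (e : anchor A y = anchor A x),
    exists W : bounded_op (lspace (anchor A x)) (H x),
      is_adjoint (lV x) W /\
      forall h : H y, K x y h = W (btransport e (lV y h));
  lPsi_mul : forall (g h : G) (p : dom g = cod h) (v : lspace (dom h)),
    ldom v ->
    btransport (cod_mul p)
      (lPsi (sgd_mul p) (btransport (esym (dom_mul p)) v)) =
    lPsi g (btransport (esym p) (lPsi h v));
  lPsi_star : forall (g : G) (w : lspace (cod g)), ldom w ->
    adjoint_graph (@ldom (dom g)) (lPsi g) w
      (btransport (cod_star g)
        (lPsi (star g) (btransport (esym (dom_star g)) w)));
  lV_ldom : forall (g : G) x (p : dom g = anchor A x) (h : H x),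
    ldom (lV x h);
  lPsi_V : forall (g : G) x (p : dom g = anchor A x) (h : H x),
    lPsi g (btransport (esym p) (lV x h)) =
    btransport (anchor_act p) (lV (act p) (transport (esym (eH g x p)) h))
}.

Arguments ldom {R k G X A H eH K} l s _.

(* The union of the V_x H_x, for x in X_s. *)
Definition lV_range (R : realType) (k : scalar_kind)
    (G : star_semigroupoid) (X : Type) (A : left_action G X)
    (H : X -> hilbert R k) (eH : invariant_bundle A H) (K : operator_kernel H)
    (L : linearisation eH K) (s : symb G) : set (lspace L s) :=
  [set v | exists (x : X) (e : anchor A x = s) (h : H x),
             v = btransport e (lV L x h)].

Arguments lV_range {R k G X A H eH K} L s _.

Definition minimal (R : realType) (k : scalar_kind)
    (G : star_semigroupoid) (X : Type) (A : left_action G X)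
    (H : X -> hilbert R k) (eH : invariant_bundle A H) (K : operator_kernel H)
    (L : linearisation eH K) :=
  forall s, closure (lin_span (lV_range L s)) = [set: lspace L s].

(* Main.v *)
From HB Require Import structures.
Require Import Defs.
From mathcomp Require Import all_boot all_order all_algebra.
From mathcomp Require Import all_classical all_reals all_analysis.
From mathcomp Require Import complex ring.

Set Implicit Arguments.
Unset Strict Implicit.
Unset Printing Implicit Defensive.

Import Order.TTheory GRing.Theory Num.Theory.
Import numFieldNormedType.Exports.

Local Open Scope classical_set_scope.
Local Open Scope ring_scope.

(** Fix a symbol s. On the pairs i = (x, h) with x in X_s and h in H_x the
    kernel K induces the scalar kernel kappa(i, j) = <K(y, x) h, v>, where
    j = (y, v), and partial positivity says exactly that kappa is Hermitian and
    positive semidefinite. Such a kernel is the Gram matrix of a total family of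
    vectors e_i in a Hilbert space K_s ([inner_kernel_vec],
    [kernel_vec_dense]). The space D_s is the span of the e_i, and V_x h is the
    vector e_(x, h). The family e is linear in h because the e_j separate the
    vectors of K_s, and V_x is bounded because |V_x h|^2 = <K(x, x) h, h>. Its
    adjoint sends e_(y, v) to K(x, y) v, and extends from D_s to K_s
    ([adjoint_of_dense]).

    An arrow g from s to t acts on pairs by g(x, h) = (g x, h), and invariance
    of K becomes kappa(g i, j) = kappa(i, g* j) ([block_act_adj]). Hence for u
    in D_s there is exactly one vector Psi(g) u such that
    <Psi(g) u, e_j> = <u, e_(g* j)> for all j: existence holds on the spanning
    vectors, where Psi(g) e_i = e_(g i), and uniqueness is the totality of the
    e_j. In general Psi(g) is unbounded. The formula gives linearity and the
    adjoint relation between Psi(g) and Psi(g* ), and the values on the e_i give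
    multiplicativity and Psi(g) V_x = V_(g x).

    For uniqueness, a minimal linearisation supplies on each block a second
    total family V'_x h with the same Gram matrix kappa, so some unitary U_s
    maps one family to the other ([same_gram_unitary]). That U intertwines the
    representations is then checked on the spanning vectors of D_s, which is
    enough because the domains D'_s are spans as well.

    The Hilbert space of a kernel is obtained without quotients, as a space of
    functions on the index set. A formal combination p of indices defines the
    function kcomb p, which takes the value sum_x p_x kappa(x, j) at j; a
    function f pairs with formal combinations, and f belongs to the space when
    it is a limit of functions kcomb p for the dual norm, that is for the best
    constant C in |<f, u>| <= C |u|. The inner product <f, g> is the limit of
    the pairings of f with the combinations that approximate g. Evaluation at j
    is the inner product with e_j, which makes the norm definite, and pointwise
    limits give completeness. *)

(** * Scalars *)

Section Scalars.
Variables (R : realType) (k : scalar_kind).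
Local Notation F := (scalars R k).
Local Notation conj := (@conj_scalar R k).

Lemma conj_scalarB : {morph conj : x y / x - y}.
Proof. by case: k => //= x y; rewrite rmorphB. Qed.

Lemma conj_scalar1 : conj 1 = 1.
Proof. by case: k => //=; rewrite rmorph1. Qed.

Lemma conj_scalarM : {morph conj : x y / x * y}.
Proof. by case: k => //= x y; rewrite rmorphM. Qed.

HB.instance Definition _ := GRing.isZmodMorphism.Build F F conj conj_scalarB.
HB.instance Definition _ :=
  GRing.isMonoidMorphism.Build F F conj (conj_scalar1, conj_scalarM).

Lemma conj_scalarK : involutive conj.
Proof. by case: k => //= x; rewrite conjCK. Qed.

Lemma mul_conj_scalar (x : F) : x * conj x = `|x| ^+ 2.
Proof.
case: k x => /= x; first by rewrite real_normK ?num_real// expr2.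
by rewrite normCK.
Qed.

Lemma norm_conj_scalar (x : F) : `|conj x| = `|x|.
Proof. by case: k x => //= x; rewrite norm_conjC. Qed.

Lemma conj_scalar_ge0 (x : F) : 0 <= x -> conj x = x.
Proof. by case: k x => //= x /geC0_conj. Qed.

(** The modulus makes the complex square root nonnegative everywhere, as the
    real one is. *)
Definition sqrt_scalar : F -> F :=
  match k return scalars R k -> scalars R k with
  | RealScalars => fun x => Num.sqrt x
  | ComplexScalars => fun x : R[i] => sqrtC `|x|
  end.

Lemma sqrt_scalar_ge0 (x : F) : 0 <= sqrt_scalar x.
Proof.
rewrite /sqrt_scalar; case: k x => /= x; first exact: sqrtr_ge0.
by rewrite sqrtC_ge0.
Qed.

Lemma sqr_sqrt_scalar (x : F) : 0 <= x -> sqrt_scalar x ^+ 2 = x.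
Proof.
rewrite /sqrt_scalar; case: k x => /= x x0; first by rewrite sqr_sqrtr.
by rewrite sqrtCK ger0_norm.
Qed.

End Scalars.

Lemma ReB (R : realType) (x y : R[i]) :
  complex.Re (x - y) = complex.Re x - complex.Re y.
Proof. by case: x y => [? ?] [? ?]. Qed.

Lemma ImB (R : realType) (x y : R[i]) :
  complex.Im (x - y) = complex.Im x - complex.Im y.
Proof. by case: x y => [? ?] [? ?]. Qed.

Lemma normc_ge_Im (R : realType) (z : R[i]) : `|complex.Im z|%:C%C <= `|z|.
Proof.
have := normc_ge_Re (z * 'i%C).
by rewrite complex.ReiNIm normrN normrM [`|'i%C|]normc_def /= expr0n add0r
  expr1n sqrtr1 mulr1.
Qed.

Lemma complex_norm_le (R : realType) (z : R[i]) :
  (complex.Re `|z|) <= `|complex.Re z| + `|complex.Im z|.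
Proof.
case: z => a b /=.
have : 0 <= `|a| + `|b| by rewrite addr_ge0.
move=> h; rewrite -(@ler_pXn2r _ 2) ?nnegrE ?sqrtr_ge0//.
rewrite sqr_sqrtr ?addr_ge0 ?sqr_ge0//.
rewrite sqrrD !real_normK ?num_real// -addrA lerD2l lerDr.
by rewrite mulrn_wge0// mulr_ge0.
Qed.

(** In the complex case the limit is taken separately for the real and the
    imaginary parts, which are Cauchy because they are dominated by the modulus.
    The condition is stated for families indexed by an arbitrary filtered type,
    since it serves limits over formal combinations and over vectors alike. *)
Lemma scalars_complete (R : realType) (k : scalar_kind) (T : Type)
    (FF : set_system T) (f : T -> scalars R k) : ProperFilter FF ->
  (forall e : scalars R k, 0 < e ->
     exists x, FF [set y | `|f x - f y| < e]) ->
  exists l, forall e : scalars R k, 0 < e -> FF [set y | `|l - f y| < e].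
Proof.
move=> PF.
have real_case (g : T -> R) :
    (forall e : R, 0 < e -> exists x, FF [set y | `|g x - g y| < e]) ->
    exists l, forall e : R, 0 < e -> FF [set y | `|l - g y| < e].
  move=> cg; have : cvg (g @ FF).
    apply: cauchy_cvg; apply: cauchy_exP => e e0.
    by have [x hx] := cg e e0; exists (g x).
  move=> /cvg_ex[l /cvgrPdist_lt hl]; exists l => e e0; exact: hl.
case: k f => f; first exact: real_case.
move=> cf.
have [] := real_case (fun x => complex.Re (f x)).
  move=> e e0; have [|x hx] := cf (e%:C)%C; first by rewrite ltcR.
  exists x; apply: filterS hx => y /= hy.
  rewrite -ltcR; apply: le_lt_trans hy.
  by rewrite -ReB; exact: normc_ge_Re.
move=> a ha; have [] := real_case (fun x => complex.Im (f x)).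
  move=> e e0; have [|x hx] := cf (e%:C)%C; first by rewrite ltcR.
  exists x; apply: filterS hx => y /= hy.
  rewrite -ltcR; apply: le_lt_trans hy.
  by rewrite -ImB; exact: normc_ge_Im.
move=> b hb; exists (a +i* b)%C => -[e e'].
rewrite ltcE/= => /andP[/eqP -> e0].
have e20 : 0 < e / 2 by rewrite divr_gt0.
apply: filterS (filterI (ha _ e20) (hb _ e20)) => y /= [h1 h2].
rewrite -[`|_|]RRe_real ?normr_real// ltcR (le_lt_trans (complex_norm_le _))//.
by rewrite ReB ImB [e]splitr ltrD.
Qed.

(** * The Hilbert space of a positive semidefinite kernel *)

Lemma quadratic_degenerate (F : fieldType) (a n : F) : 2 * n != 0 ->
  a - (a + 1) * ((2 * n)^-1 * n) - (a + 1) * ((2 * n)^-1 * n) = -1.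
Proof.
by rewrite mulf_eq0 negb_or => /andP[two_neq0 n_neq0]; field; apply/andP.
Qed.

Lemma quadratic_minimum (F : fieldType) (a b c d : F) : b != 0 ->
  (a - d / b * c - c / b * d + c / b * (d / b) * b) * b = a * b - d * c.
Proof. by move=> b_neq0; field. Qed.

(** Minimising the quadratic expression in t: its value at t = c / b is
    a - |c|^2 / b. *)
Lemma cauchy_schwarz_scalar (R : realType) (k : scalar_kind)
    (a b c : scalars R k) : 0 <= b ->
  (forall t, 0 <= a - conj_scalar t * c - t * conj_scalar c
                  + t * conj_scalar t * b) ->
  `|c| ^+ 2 <= a * b.
Proof.
move=> b0 pos; have a0 : 0 <= a.
  by have := pos 0; rewrite rmorph0 !mul0r !subr0 addr0.
have cE : conj_scalar c * c = `|c| ^+ 2 by rewrite mulrC mul_conj_scalar.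
have [b_eq0|b_neq0] := eqVneq b 0.
  rewrite b_eq0 mulr0; have [->|c_neq0] := eqVneq c 0.
    by rewrite normr0 expr0n.
  have n_gt0 : 0 < `|c| ^+ 2 by rewrite exprn_gt0// normr_gt0.
  (* when b = 0 the expression is affine in t, and negative for this t *)
  have := pos ((a + 1) / (2 * `|c| ^+ 2) * c).
  rewrite b_eq0 mulr0 addr0 rmorphM/= conj_scalar_ge0; last first.
    by rewrite divr_ge0 ?addr_ge0// mulr_ge0// ltW.
  rewrite -!mulrA cE mul_conj_scalar quadratic_degenerate ?ler0N1//.
  by rewrite mulf_neq0 ?pnatr_eq0// gt_eqF.
have b_gt0 : 0 < b by rewrite lt_neqAle eq_sym b_neq0.
have := pos (c / b).
rewrite rmorphM/= (@conj_scalar_ge0 _ _ b^-1) ?invr_ge0//.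
by rewrite -(pmulr_lge0 _ b_gt0) quadratic_minimum// cE subr_ge0.
Qed.

Record psd_kernel (R : realType) (k : scalar_kind) (I : Type) := PsdKernel {
  psd_ker :> I -> I -> scalars R k;
  psd_ker_herm : forall i j, psd_ker j i = conj_scalar (psd_ker i j);
  psd_ker_ge0 : forall p : seq (scalars R k * I),
    0 <= \sum_(x <- p) \sum_(y <- p)
           x.1 * conj_scalar y.1 * psd_ker x.2 y.2
}.

Section KernelSpace.
Variables (R : realType) (k : scalar_kind) (I : Type).
Variable K : psd_kernel R k I.
Local Notation F := (scalars R k).
Local Notation conj := (@conj_scalar R k).

(** A list of pairs (c, i) stands for the formal linear combination of the
    indices i with coefficients c. *)
Definition pair_comb (f : I -> F) (u : seq (F * I)) : F :=
  \sum_(x <- u) conj x.1 * f x.2.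

Definition kcomb (p : seq (F * I)) : I -> F :=
  fun j => \sum_(x <- p) x.1 * K x.2 j.

Definition scale_comb (c : F) (p : seq (F * I)) := [seq (c * x.1, x.2) | x <-
  p].

Definition gram p u := pair_comb (kcomb p) u.

Definition gnorm p := sqrt_scalar (gram p p).

Lemma pair_combP c f g u :
  pair_comb (c *: f + g) u = c * pair_comb f u + pair_comb g u.
Proof.
rewrite /pair_comb big_distrr/= -big_split/=; apply: eq_bigr => x _.
by rewrite mulrDr mulrCA.
Qed.

Lemma pair_combB f g u : pair_comb (f - g) u = pair_comb f u - pair_comb g u.
Proof.
by rewrite addrC -scaleN1r pair_combP mulN1r addrC.
Qed.

Lemma pair_comb_cat f u v :
  pair_comb f (u ++ v) = pair_comb f u + pair_comb f v.
Proof. by rewrite /pair_comb big_cat. Qed.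

Lemma pair_comb_scale f c u :
  pair_comb f (scale_comb c u) = conj c * pair_comb f u.
Proof.
rewrite /pair_comb big_map big_distrr/=; apply: eq_bigr => x _.
by rewrite rmorphM mulrA.
Qed.

Lemma pair_comb1 f i : pair_comb f [:: (1, i)] = f i.
Proof. by rewrite /pair_comb big_seq1/= rmorph1 mul1r. Qed.

Lemma kcomb_cat p q : kcomb (p ++ q) = kcomb p + kcomb q.
Proof. by apply/funext => j; rewrite /kcomb big_cat. Qed.

Lemma kcomb_scale c p : kcomb (scale_comb c p) = c *: kcomb p.
Proof.
apply/funext => j; rewrite /kcomb big_map.
under eq_bigr do rewrite -mulrA.
by rewrite -big_distrr.
Qed.

Lemma gramE p q :
  gram p q = \sum_(x <- p) \sum_(y <- q) x.1 * conj y.1 * K x.2 y.2.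
Proof.
rewrite exchange_big/=; apply: eq_bigr => y _.
rewrite big_distrr/=; apply: eq_bigr => x _.
by rewrite mulrCA mulrA.
Qed.

Lemma gram_ge0 p : 0 <= gram p p.
Proof. by rewrite gramE; exact: psd_ker_ge0. Qed.

Lemma gram_herm p q : gram q p = conj (gram p q).
Proof.
rewrite !gramE exchange_big/= rmorph_sum/=; apply: eq_bigr => x _.
rewrite rmorph_sum/=; apply: eq_bigr => y _.
by rewrite psd_ker_herm !rmorphM/= conj_scalarK [y.1 * _]mulrC.
Qed.

Lemma gnorm_ge0 p : 0 <= gnorm p.
Proof. exact: sqrt_scalar_ge0. Qed.

Lemma sqr_gnorm p : gnorm p ^+ 2 = gram p p.
Proof. by rewrite sqr_sqrt_scalar// gram_ge0. Qed.

Lemma gram_cauchy_schwarz p q : `|gram p q| <= gnorm p * gnorm q.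
Proof.
rewrite -(@ler_pXn2r _ 2) ?nnegrE ?mulr_ge0 ?gnorm_ge0//.
rewrite exprMn !sqr_gnorm; apply: cauchy_schwarz_scalar; first exact: gram_ge0.
move=> t; have := gram_ge0 (p ++ scale_comb (- t) q).
rewrite /gram kcomb_cat kcomb_scale -[kcomb p + _]addrC pair_combP.
rewrite !pair_comb_cat !pair_comb_scale -!/(gram _ _) [gram q p]gram_herm
  rmorphN/=.
rewrite mulrDr addrA mulNr mulrCA mulrA mulNr mulrN opprK mulNr.
rewrite [conj t * t]mulrC; congr (0 <= _).
by rewrite [LHS]addrC !addrA [LHS]addrC !addrA.
Qed.

(** [dual_bound f C] says that the dual norm of f is at most C. *)
Definition dual_bound (f : I -> F) (C : F) :=
  forall u, `|pair_comb f u| <= C * gnorm u.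

Lemma dual_bound_kcomb p : dual_bound (kcomb p) (gnorm p).
Proof. by move=> u; exact: gram_cauchy_schwarz. Qed.

(** The dual norm of [kcomb p] is attained at p. *)
Lemma gnorm_le_dual_bound p C : 0 <= C -> dual_bound (kcomb p) C -> gnorm p <=
  C.
Proof.
move=> C0 /(_ p); rewrite -/(gram p p) ger0_norm ?gram_ge0// -sqr_gnorm expr2.
have := gnorm_ge0 p; rewrite le_eqVlt => /predU1P[<- //|p0].
by rewrite ler_pM2r.
Qed.

Lemma dual_boundP c f g A B : dual_bound f A -> dual_bound g B ->
  dual_bound (c *: f + g) (`|c| * A + B).
Proof.
move=> hf hg u; rewrite pair_combP (le_trans (ler_normD _ _))// mulrDl lerD//.
by rewrite normrM -mulrA ler_wpM2l.
Qed.

Lemma dual_boundB f g A B : dual_bound f A -> dual_bound g B ->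
  dual_bound (f - g) (B + A).
Proof.
move=> hf hg; rewrite addrC -scaleN1r -[B]mul1r -[X in X * B](@normr1 F)
  -normrN.
exact: dual_boundP.
Qed.

Lemma dual_bound_le f A B : A <= B -> dual_bound f A -> dual_bound f B.
Proof.
move=> AB hf u; rewrite (le_trans (hf u))// ler_wpM2r// gnorm_ge0//.
Qed.

(** The completion of the formal combinations is realised inside the functions
    on the index set, as the closure of the functions [kcomb p] for the dual
    norm. *)
Definition kspace_pred : {pred I -> F} := [pred f |
  `[< forall e, 0 < e -> exists p, dual_bound (f - kcomb p) e >]].

Lemma kspaceP f : reflect
  (forall e, 0 < e -> exists p, dual_bound (f - kcomb p) e) (f \in kspace_pred).
Proof. exact: asboolP. Qed.

Lemma kcomb_kspace p : kcomb p \in kspace_pred.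
Proof.
apply/kspaceP => e e0; exists p => u; rewrite subrr /pair_comb big1 ?normr0.
  by rewrite mulr_ge0 ?gnorm_ge0// ltW.
by move=> x _; rewrite mulr0.
Qed.

Lemma kspace_submod_closed : submod_closed kspace_pred.
Proof.
split=> [|c f g /kspaceP hf /kspaceP hg].
  have -> : (0 : I -> F) = kcomb [::].
    by apply/funext => j; rewrite /kcomb big_nil.
  exact: kcomb_kspace.
apply/kspaceP => e e0.
have c0 : 0 < `|c| + 1 by rewrite ltr_wpDl.
have [p hp] := hf _ (divr_gt0 (divr_gt0 e0 (@ltr0Sn F 1)) c0).
have [q hq] := hg _ (divr_gt0 e0 (@ltr0Sn F 1)).
exists (scale_comb c p ++ q); rewrite kcomb_cat kcomb_scale.
rewrite opprD addrACA -scalerBr; apply: dual_bound_le (dual_boundP c hp hq).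
rewrite [leRHS]splitr lerD2r mulrA ler_pdivrMr// mulrC ler_wpM2l//.
  by rewrite divr_ge0// ltW.
by rewrite lerDl.
Qed.

HB.instance Definition _ :=
  GRing.isSubmodClosed.Build F (I -> F) kspace_pred kspace_submod_closed.

Record kspace := KSpace { kspace_fun : I -> F; _ : kspace_fun \in kspace_pred }.

HB.instance Definition _ := [isSub for kspace_fun].
HB.instance Definition _ := [Choice of kspace by <:].
HB.instance Definition _ := [SubChoice_isSubLmodule of kspace by <:].

End KernelSpace.

(** Restricting to e <= 1 lets error terms quadratic in e be bounded by linear
    ones. *)
Lemma ler_addmul_gt0 (F : numFieldType) (x y M : F) : 0 <= M ->
  (forall e, 0 < e <= 1 -> x <= y + M * e) -> x <= y.
Proof.
move=> M0 h; apply/ler_addgt0Pr => e e0.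
have M1 : 0 < M + 1 + e by rewrite ltr_wpDl// addr_ge0.
apply: le_trans (h (e / (M + 1 + e)) _) _.
  by rewrite divr_gt0// ler_pdivrMr// mul1r lerDr addr_ge0.
rewrite lerD2l mulrA ler_pdivrMr// mulrC ler_wpM2l ?(ltW e0)//.
by rewrite -addrA lerDl addr_ge0// ltW.
Qed.

Lemma eq_scalar_approx (F : numFieldType) (x y M : F) : 0 <= M ->
  (forall e, 0 < e <= 1 -> `|x - y| <= M * e) -> x = y.
Proof.
move=> M0 h; apply/subr0_eq/normr0_eq0/eqP; rewrite eq_le normr_ge0 andbT.
by apply: (ler_addmul_gt0 M0) => e e0; rewrite add0r h.
Qed.

Section KernelInner.
Variables (R : realType) (k : scalar_kind) (I : Type).
Variable K : psd_kernel R k I.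
Local Notation F := (scalars R k).
Local Notation E := (kspace K).
Implicit Types (f g h : E) (p q r : seq (F * I)) (c d e C : F).

Lemma kspace_valP c f g : \val (c *: f + g) = c *: \val f + \val g :> (I -> F).
Proof. by rewrite linearP. Qed.

Lemma kspace_approx f e : 0 < e ->
  exists p, dual_bound K (\val f - kcomb K p) e.
Proof. by move: e; apply/kspaceP; exact: (valP f). Qed.

Lemma dual_bound_ex f : exists2 C, 0 < C & dual_bound K (\val f) C.
Proof.
have [p hp] := kspace_approx f (@ltr01 F).
exists (1 + gnorm K p); first by rewrite ltr_wpDr// gnorm_ge0.
by have := dual_boundP 1 hp (dual_bound_kcomb K p);
  rewrite scale1r subrK normr1 mul1r.
Qed.

(** [r ++ scale_comb (- 1) s] is the formal difference of r and s: combinations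
    that approximate the same function are close to each other. *)
Lemma gnorm_approx_sub (f : I -> F) r s d e : 0 <= d -> 0 <= e ->
  dual_bound K (f - kcomb K r) d -> dual_bound K (f - kcomb K s) e ->
  gnorm K (r ++ scale_comb (- 1) s) <= d + e.
Proof.
move=> d0 e0 hr hs; apply: gnorm_le_dual_bound; first exact: addr_ge0.
rewrite kcomb_cat kcomb_scale scaleN1r.
have -> : kcomb K r - kcomb K s = (f - kcomb K s) - (f - kcomb K r).
  by rewrite opprB [RHS]addrC addrA subrK.
exact: dual_boundB.
Qed.

Lemma pair_comb_approx_sub (g : I -> F) (f : I -> F) C r s d e :
  0 <= C -> 0 <= d -> 0 <= e -> dual_bound K f C ->
  dual_bound K (g - kcomb K r) d -> dual_bound K (g - kcomb K s) e ->
  `|pair_comb f r - pair_comb f s| <= C * (d + e).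
Proof.
move=> C0 d0 e0 hf hr hs.
have -> : pair_comb f r - pair_comb f s = pair_comb f (r ++ scale_comb (- 1) s).
  by rewrite pair_comb_cat pair_comb_scale rmorphN rmorph1 mulN1r.
by rewrite (le_trans (hf _))// ler_wpM2l// (gnorm_approx_sub d0 e0 hr hs).
Qed.

Definition near_comb g : set_system (seq (F * I)) :=
  [set B | exists2 e, 0 < e &
     forall p, dual_bound K (\val g - kcomb K p) e -> B p].

Instance near_comb_filter g : ProperFilter (near_comb g).
Proof.
split.
  move=> [e e0 h]; have [p hp] := kspace_approx g e0; exact: h hp.
split.
- by exists 1.
- move=> A B [d d0 hA] [e e0 hB].
  have [de|/ltW ed] := real_leP (gtr0_real d0) (gtr0_real e0).
    exists d => // p hp; split; first exact: hA.
    exact/hB/(dual_bound_le de).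
  exists e => // p hp; split; last exact: hB.
  exact/hA/(dual_bound_le ed).
- by move=> A B AB [e e0 hA]; exists e => // p /hA /AB.
Qed.

Definition kinner f g : F := lim (pair_comb (\val f) @ near_comb g).

Lemma kinner_cvg f g e : 0 < e ->
  near_comb g [set r | `|kinner f g - pair_comb (\val f) r| < e].
Proof.
move=> e_gt0; have [C C0 hC] := dual_bound_ex f.
have [] := @scalars_complete R k _ (near_comb g) (pair_comb (\val f)) _.
  move=> {e_gt0}e e0; pose d := e / 3 / C.
  have d0 : 0 < d by rewrite !divr_gt0.
  have Cd : C * d = e / 3 by rewrite mulrC divfK// gt_eqF.
  have [p hp] := kspace_approx g d0.
  exists p, d => // r hr.
  apply: le_lt_trans (pair_comb_approx_sub (ltW C0) (ltW d0) (ltW d0) hC hp hr)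
    _.
  rewrite mulrDr Cd -mulrDl ltr_pdivrMr// -mulr2n -[e *+ 2]mulr_natr.
  by rewrite ltr_pM2l// ltr_nat.
move=> l hl.
suff -> : kinner f g = l by exact: hl.
apply: cvg_lim; first exact: norm_hausdorff.
by apply/cvgrPdist_lt; exact: hl.
Qed.

(** All estimates about the inner product go through this one. *)
Lemma kinner_approx f g C r d : 0 <= C -> 0 <= d ->
  dual_bound K (\val f) C -> dual_bound K (\val g - kcomb K r) d ->
  `|kinner f g - pair_comb (\val f) r| <= C * d.
Proof.
move=> C0 d0 hC hr; apply: (@ler_addmul_gt0 _ _ _ (1 + C)) => [|e /andP[e0 _]].
  exact: addr_ge0.
have [s [h hs]] : exists s, `|kinner f g - pair_comb (\val f) s| < e /\
    dual_bound K (\val g - kcomb K s) e.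
  apply: (@filter_ex _ (near_comb g)); apply: filterI; first exact: kinner_cvg.
  by exists e.
rewrite (le_trans (ler_distD (pair_comb (\val f) s) _ _))// mulrDl mul1r.
rewrite addrCA lerD//; first exact: ltW.
by rewrite -mulrDr [d + e]addrC (pair_comb_approx_sub C0 (ltW e0) d0 hC hs hr).
Qed.

Lemma kinner_linear c f g h :
  kinner (c *: f + g) h = c * kinner f h + kinner g h.
Proof.
have [A A0 hA] := dual_bound_ex f; have [B B0 hB] := dual_bound_ex g.
have hAB := dual_boundP c hA hB; rewrite -kspace_valP in hAB.
have AB0 : 0 <= `|c| * A + B by rewrite addr_ge0 ?mulr_ge0// ltW.
apply: (@eq_scalar_approx _ _ _ (`|c| * A + B + (`|c| * A + B))) => [|e
  /andP[e0 _]].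
  exact: addr_ge0.
have [r hr] := kspace_approx h e0.
rewrite (le_trans (ler_distD (pair_comb (\val (c *: f + g)) r) _ _))// mulrDl.
rewrite lerD ?kinner_approx// ?(ltW e0)//.
rewrite kspace_valP pair_combP opprD addrACA -mulrBr.
rewrite (le_trans (ler_normD _ _))// mulrDl lerD//.
  rewrite normrM distrC -mulrA ler_wpM2l// kinner_approx// ltW//.
by rewrite distrC kinner_approx// ltW.
Qed.

Lemma gnorm_approx f C p d : 0 <= C -> 0 <= d ->
  dual_bound K (\val f) C -> dual_bound K (\val f - kcomb K p) d ->
  gnorm K p <= C + d.
Proof.
move=> C0 d0 hC hp; apply: gnorm_le_dual_bound; first exact: addr_ge0.
have -> : kcomb K p = \val f - (\val f - kcomb K p) by rewrite opprB [RHS]addrC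
  subrK.
by rewrite [C + d]addrC; exact: dual_boundB.
Qed.

(** Replacing g by r costs A e; replacing f by p then costs e |r|, and |r| is at
    most B + e. *)
Lemma kinner_gram f g A B p r e : 0 <= A -> 0 <= B -> 0 < e <= 1 ->
  dual_bound K (\val f) A -> dual_bound K (\val g) B ->
  dual_bound K (\val f - kcomb K p) e -> dual_bound K (\val g - kcomb K r) e ->
  `|kinner f g - gram K p r| <= (A + (B + 1)) * e.
Proof.
move=> A0 B0 /andP[e0 e1] hA hB hp hr; have e0' := ltW e0.
rewrite (le_trans (ler_distD (pair_comb (\val f) r) _ _))// mulrDl.
rewrite lerD ?kinner_approx// -pair_combB (le_trans (hp r))// mulrC ler_wpM2r//.
by rewrite (le_trans (gnorm_approx B0 e0' hB hr))// lerD2l.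
Qed.

Lemma kinner_herm f g : kinner g f = conj_scalar (kinner f g).
Proof.
have [A /ltW A0 hA] := dual_bound_ex f; have [B /ltW B0 hB] := dual_bound_ex g.
apply: (@eq_scalar_approx _ _ _ ((B + (A + 1)) + (A + (B + 1)))) => [|e e01].
  by rewrite !addr_ge0.
have /andP[e0 _] := e01.
have [p hp] := kspace_approx f e0; have [r hr] := kspace_approx g e0.
rewrite (le_trans (ler_distD (gram K r p) _ _))// mulrDl.
rewrite lerD ?kinner_gram// gram_herm -rmorphB norm_conj_scalar distrC.
exact: kinner_gram.
Qed.

Lemma kinner_ge0 f : 0 <= kinner f f.
Proof.
have [A /ltW A0 hA] := dual_bound_ex f; set c := kinner f f.
(* a scalar is nonnegative when it equals its modulus *)
suff -> : c = `|c| by [].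
apply: (@eq_scalar_approx _ _ _ ((A + (A + 1)) + (A + (A + 1)))) => [|e e01].
  by rewrite !addr_ge0.
have /andP[e0 _] := e01; have [p hp] := kspace_approx f e0.
have hc := kinner_gram A0 A0 e01 hA hA hp hp.
rewrite (le_trans (ler_distD (gram K p p) _ _))// mulrDl lerD//.
rewrite -{1}[gram K p p]ger0_norm ?gram_ge0//.
by rewrite (le_trans (ler_dist_dist _ _))// distrC.
Qed.

Definition kspace_comb p : E := KSpace (kcomb_kspace K p).

Lemma kinner_comb f p : kinner f (kspace_comb p) = pair_comb (\val f) p.
Proof.
have [C /ltW C0 hC] := dual_bound_ex f.
apply: (@eq_scalar_approx _ _ _ 0) => [//|e _].
rewrite mul0r -(mulr0 C) kinner_approx// => u.
by rewrite pair_combB/= subrr normr0 mul0r.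
Qed.

Lemma kinner_linear_r c f g h :
  kinner h (c *: f + g) = conj_scalar c * kinner h f + kinner h g.
Proof.
by rewrite kinner_herm kinner_linear rmorphD rmorphM/= -!(kinner_herm _ h).
Qed.

Definition knorm f : F := sqrt_scalar (kinner f f).

Lemma knorm_ge0 f : 0 <= knorm f.
Proof. exact: sqrt_scalar_ge0. Qed.

Lemma sqr_knorm f : knorm f ^+ 2 = kinner f f.
Proof. by rewrite sqr_sqrt_scalar// kinner_ge0. Qed.

Lemma kinner_cauchy_schwarz f g : `|kinner f g| <= knorm f * knorm g.
Proof.
rewrite -(@ler_pXn2r _ 2) ?nnegrE ?mulr_ge0 ?knorm_ge0//.
rewrite exprMn !sqr_knorm; apply: cauchy_schwarz_scalar;
  first exact: kinner_ge0.
move=> t; have := kinner_ge0 (- t *: g + f).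
rewrite kinner_linear !kinner_linear_r [kinner g f]kinner_herm rmorphN/=.
rewrite mulrDr addrA !mulNr !mulrN opprK mulrA; congr (0 <= _).
by rewrite [LHS]addrC [X in _ + X = _]addrC [X in _ + (_ + X) = _]addrC !addrA.
Qed.

Lemma knorm_comb p : knorm (kspace_comb p) = gnorm K p.
Proof. by rewrite /knorm kinner_comb. Qed.

Lemma dual_bound_knorm f : dual_bound K (\val f) (knorm f).
Proof.
move=> u; rewrite -kinner_comb -knorm_comb; exact: kinner_cauchy_schwarz.
Qed.

(** With [dual_bound_knorm] this identifies the Hilbert norm with the dual norm:
    if p approximates f, then <f, f> is close to the pairing of f with p, which
    is at most C |p|, and |p| is close to at most C. *)
Lemma knorm_le_dual_bound f C : 0 <= C -> dual_bound K (\val f) C -> knorm f <=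
  C.
Proof.
move=> C0 hC; rewrite -(@ler_pXn2r _ 2) ?nnegrE ?knorm_ge0// sqr_knorm.
apply: (@ler_addmul_gt0 _ _ _ (C + C)) => [|e /andP[e_gt0 _]].
  exact: addr_ge0.
have e0 := ltW e_gt0; have [p hp] := kspace_approx f e_gt0.
rewrite -[kinner f f]ger0_norm ?kinner_ge0//.
rewrite -[kinner f f](subrK (pair_comb (\val f) p)).
rewrite (le_trans (ler_normD _ _))// mulrDl addrA addrC lerD//.
  exact: kinner_approx.
rewrite (le_trans (hC p))// expr2 -mulrDr ler_wpM2l//.
exact: gnorm_approx.
Qed.

Lemma knorm_eq0 f : knorm f = 0 -> f = 0.
Proof.
move=> f0; apply/val_inj/funext => i /=.
have := dual_bound_knorm f [:: (1, i)].
by rewrite f0 mul0r pair_comb1 normr_le0 => /eqP.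
Qed.

Lemma ler_knormD f g : knorm (f + g) <= knorm f + knorm g.
Proof.
apply: knorm_le_dual_bound; first by rewrite addr_ge0 ?knorm_ge0.
have := dual_boundP 1 (dual_bound_knorm f) (dual_bound_knorm g).
by rewrite -kspace_valP scale1r normr1 mul1r.
Qed.

HB.instance Definition _ := @bilinear_isBilinear.Build F E E F
  *%R (@conj_scalar R k \; *%R) kinner
  (fun h c f g => kinner_linear c f g h, fun h c f g => kinner_linear_r c f g
    h).

Lemma kinner_hermitian f g :
  kinner f g = (-1) ^+ false * conj_scalar (kinner g f).
Proof. by rewrite expr0 mul1r -kinner_herm. Qed.

HB.instance Definition _ := @isHermitianSesquilinear.Build F E false
  (@conj_scalar R k) kinner kinner_hermitian.

Lemma kinner_gt0 f : f != 0 -> 0 < kinner f f.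
Proof.
move=> f_neq0; rewrite lt_def kinner_ge0 andbT -sqr_knorm sqrf_eq0.
by apply: contra f_neq0 => /eqP /knorm_eq0 ->.
Qed.

HB.instance Definition _ := @isDotProduct.Build F E kinner kinner_gt0.

Lemma knormZ c f : knorm (c *: f) = `|c| * knorm f.
Proof.
apply/eqP; rewrite -(@eqrXn2 _ 2) ?mulr_ge0 ?knorm_ge0// exprMn !sqr_knorm.
by rewrite linearZl_LR linearZr_LR/= mulrA mul_conj_scalar.
Qed.

HB.instance Definition _ := Lmodule_isNormed.Build F E
  ler_knormD knormZ knorm_eq0.

End KernelInner.

Section KernelComplete.
Variables (R : realType) (k : scalar_kind) (I : Type).
Variable K : psd_kernel R k I.
Local Notation F := (scalars R k).
Local Notation E := (kspace K).

Lemma knormE (f : E) : `|f| = knorm f.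
Proof. by []. Qed.

Lemma pair_comb_cvg (T : Type) (FF : set_system T) (h : T -> I -> F)
    (l : I -> F) (u : seq (F * I)) : Filter FF ->
  (forall i, h x i @[x --> FF] --> l i) ->
  pair_comb (h x) u @[x --> FF] --> pair_comb l u.
Proof.
move=> FFF hl; rewrite /pair_comb; elim: u => [|a u IHu].
  rewrite big_nil; under eq_cvg do rewrite big_nil; exact: cvg_cst.
rewrite big_cons; under eq_cvg do rewrite big_cons.
by apply: cvgD => //; apply: cvgM => //; exact: cvg_cst.
Qed.

(** The limit of a Cauchy filter is computed pointwise; the dual norm controls
    the distance to it because pointwise limits preserve the bounds
    [dual_bound]. *)
Lemma kspace_complete (FF : set_system E) : ProperFilter FF ->
  cauchy FF -> cvg FF.
Proof.
move=> PF /cauchyP cFF.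
have ev_le (f : E) i : `|\val f i| <= `|f| * gnorm K [:: (1, i)].
  by rewrite -(pair_comb1 (\val f)); exact: dual_bound_knorm.
have /choice[l hl] : forall i, exists li : F, \val f i @[f --> FF] --> li.
  move=> i; set c := gnorm K [:: (1, i)].
  have c0 : 0 < c + 1 by rewrite ltr_wpDl// gnorm_ge0.
  have [e e0|li hli] := @scalars_complete R k _ FF (fun f => \val f i) PF;
    last first.
    by exists li; apply/cvgrPdist_lt; exact: hli.
  have [x hx] := cFF _ (divr_gt0 e0 c0); exists x; apply: filterS hx => y.
  rewrite -ball_normE/= ltr_pdivlMr// => hy; rewrite -[X in `|X|]/((\val x -
    \val y) i).
  have -> : \val x - \val y = \val (x - y) by rewrite raddfB.
  apply: le_lt_trans (ev_le _ _) (le_lt_trans _ hy).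
  by rewrite ler_wpM2l// lerDl.
have l_bound (x : E) e : FF (ball x e) -> dual_bound K (l - \val x) e.
  move=> hx u; apply/ler_addgt0Pr => d d0.
  have hu : pair_comb (\val f) u @[f --> FF] --> pair_comb l u.
    exact: pair_comb_cvg.
  have /cvgrPdist_lt/(_ d d0) hd := hu.
  have [h [/= h1 h2]] := @filter_ex _ FF PF _ (filterI hd hx).
  rewrite pair_combB (le_trans (ler_distD (pair_comb (\val h) u) _ _))//.
  rewrite addrC lerD//; last exact: ltW.
  rewrite -pair_combB.
  have -> : \val h - \val x = \val (h - x) by rewrite raddfB.
  rewrite (le_trans (dual_bound_knorm _ _))// ler_wpM2r ?gnorm_ge0//.
  by move: h2; rewrite -ball_normE/= distrC => /ltW.
have l_in : l \in kspace_pred K.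
  apply/kspaceP => e e0; have e20 : 0 < e / 2 by rewrite divr_gt0.
  have [x hx] := cFF _ e20; have [p hp] := kspace_approx x e20.
  exists p; have -> : l - kcomb K p = (l - \val x) - (kcomb K p - \val x).
    by rewrite opprB addrA subrK.
  rewrite [e]splitr; apply: dual_boundB; first exact: l_bound.
  by move=> u; rewrite pair_combB distrC -pair_combB; exact: hp.
pose g : E := KSpace l_in.
apply/cvg_ex; exists g; apply/fcvgrPdist_lt => e e0.
have e20 : 0 < e / 2 by rewrite divr_gt0.
have [x hx] := cFF _ e20; have hgx := l_bound _ _ hx.
apply: filterS hx => y; rewrite -ball_normE/= => xy.
rewrite (le_lt_trans (ler_distD x _ _))// [e]splitr ler_ltD//.
by rewrite knormE; apply: knorm_le_dual_bound; rewrite ?raddfB// ltW.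
Qed.

HB.instance Definition _ := Uniform_isComplete.Build E kspace_complete.

Lemma kinnerxx (u : E) : kinner u u = `|u| ^+ 2.
Proof. by rewrite knormE sqr_knorm. Qed.

Definition kernel_hilbert : hilbert R k := @Hilbert R k E (@kinner R k I K)
  kinnerxx.

Definition kernel_vec (i : I) : kernel_hilbert := kspace_comb K [:: (1, i)].

Lemma inner_kernel_vec i j :
  inner kernel_hilbert (kernel_vec i) (kernel_vec j) = K i j.
Proof.
by rewrite [LHS]kinner_comb pair_comb1 /= /kcomb big_seq1 mul1r.
Qed.

End KernelComplete.

(** * Linear spans and closed relations *)

Section LinSpan.
Variables (F : numFieldType) (V : lmodType F) (A : set V).

Lemma lin_span_ind (P : V -> Prop) : P 0 ->
  (forall c a v, A a -> lin_span A v -> P v -> P (c *: a + v)) ->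
  forall v, lin_span A v -> P v.
Proof.
move=> P0 PS v [n [c [u [hu ->]]]]; elim: n c u hu => [|n IHn] c u hu.
  by rewrite big_ord0.
rewrite big_ord_recl; apply: PS => //; last exact: IHn.
by exists n, (fun i => c (lift ord0 i)), (fun i => u (lift ord0 i)).
Qed.

Lemma lin_span0 : lin_span A 0.
Proof.
exists 0%N, (fun=> 0), (fun=> 0).
by split => [[]|]; rewrite // big_ord0.
Qed.

Lemma lin_span_cons c a v : A a -> lin_span A v -> lin_span A (c *: a + v).
Proof.
move=> Aa [n [d [u [hu ->]]]].
exists n.+1, (fun i => oapp d c (unlift ord0 i)), (fun i => oapp u a (unlift
  ord0 i)).
split=> [i|]; first by case: unliftP => [j|] _ /=.
rewrite big_ord_recl unlift_none/=; congr (_ + _).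
by apply: eq_bigr => i _; rewrite liftK.
Qed.

Lemma lin_span_mem a : A a -> lin_span A a.
Proof.
by move=> Aa; rewrite -[a]scale1r -[_ *: _]addr0; apply/lin_span_cons/lin_span0.
Qed.

Lemma lin_span_subspace : subspace_set (lin_span A).
Proof.
split=> [|c u v hu hv]; first exact: lin_span0.
elim/lin_span_ind : hu => [|d a w Aa _ IHw]; first by rewrite scaler0 add0r.
by rewrite scalerDr scalerA -addrA; exact: lin_span_cons.
Qed.

End LinSpan.

Definition norm_dense (F : numFieldType) (V : normedModType F) (D : set V) :=
  forall u e, 0 < e -> exists2 d, D d & `|u - d| < e.

Lemma norm_dense_dense (F : numFieldType) (V : normedModType F) (D : set V) :
  norm_dense D -> dense D.
Proof.
move=> hD O [u Ou] oO.
have /nbhs_ballP[e /= e0 he] : nbhs u O by exact: open_nbhs_nbhs.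
have [d Dd ud] := hD u e e0; exists d; split => //.
by apply: he; rewrite -ball_normE.
Qed.

Lemma closureT_norm_dense (F : numFieldType) (V : normedModType F) (D : set V) :
  closure D = setT <-> norm_dense D.
Proof.
split=> [hD u e e0|hD].
  have : closure D u by rewrite hD.
  move=> /(_ (ball u e)) [|d [Dd]]; first exact: nbhsx_ballx.
  by rewrite -ball_normE/=; exists d.
rewrite -subTset => u _ B /nbhs_ballP[e /= e0 he].
have [d Dd ud] := hD u e e0; exists d; split => //.
by apply: he; rewrite -ball_normE.
Qed.

(** Bounded operators are built from their graphs: on a Cauchy filter of points
    of the domain converging to u, the corresponding values form a Cauchy
    filter, whose limit is the value at u. *)
Lemma closed_relation_operator (F : numFieldType) (V : normedModType F)
    (W : completeNormedModType F) (G : V -> W -> Prop) (C : F) : 0 <= C ->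
  (forall c u w u' w', G u w -> G u' w' -> G (c *: u + u') (c *: w + w')) ->
  (forall u w, G u w -> `|w| <= C * `|u|) ->
  (forall u w, (forall e, 0 < e -> exists u' w',
     [/\ G u' w', `|u - u'| < e & `|w - w'| < e]) -> G u w) ->
  norm_dense [set u | exists w, G u w] ->
  exists T : {linear V -> W}, forall u, G u (T u).
Proof.
move=> C0 GP Gbound Gclosed Gdense.
have GB u w u' w' : G u w -> G u' w' -> G (u - u') (w - w').
  move=> h h'; rewrite [u - u']addrC [w - w']addrC -(scaleN1r u') -(scaleN1r
    w').
  exact: GP.
have Ginj u w w' : G u w -> G u w' -> w = w'.
  move=> h h'; apply/subr0_eq/normr0_eq0/eqP; rewrite eq_le normr_ge0 andbT.
  by rewrite (le_trans (Gbound _ _ (GB _ _ _ _ h h')))// subrr normr0 mulr0.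
have /choice[T hT] : forall u, exists w, G u w.
  move=> u.
  pose FF : set_system W := [set B | exists2 e, 0 < e &
    forall u' w', G u' w' -> `|u - u'| < e -> B w'].
  have FFF : ProperFilter FF.
    split.
      move=> [e e0 h]; have [u' [w' Gu'] uu'] := Gdense u e e0.
      exact: h Gu' uu'.
    split.
    - by exists 1.
    - move=> A B [d d0 hA] [e e0 hB].
      have [de|/ltW ed] := real_leP (gtr0_real d0) (gtr0_real e0).
        exists d => // u' w' Gu' uu'; split; first exact: hA Gu' uu'.
        by apply: hB Gu' _; exact: lt_le_trans de.
      exists e => // u' w' Gu' uu'; split; last exact: hB Gu' uu'.
      by apply: hA Gu' _; exact: lt_le_trans ed.
    - by move=> A B AB [e e0 hA]; exists e => // u' w' Gu' uu';
      exact/AB/(hA u').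
  have : cvg FF.
    apply: cauchy_cvg; apply: cauchy_exP => e e0.
    have C1 : 0 < C + 1 by rewrite ltr_wpDl.
    have d0 : 0 < e / (C + 1) / 2 by rewrite !divr_gt0.
    have [u1 [w1 Gu1] uu1] := Gdense u _ d0.
    exists w1, (e / (C + 1) / 2) => // u2 w2 Gu2 uu2.
    rewrite -ball_normE/= (le_lt_trans (Gbound _ _ (GB _ _ _ _ Gu1 Gu2)))//.
    have : `|u1 - u2| < e / (C + 1).
      rewrite (le_lt_trans (ler_distD u _ _))// [ltRHS]splitr ltrD//.
      by rewrite distrC.
    rewrite ltr_pdivlMr//; apply: le_lt_trans.
    by rewrite mulrC ler_wpM2l// lerDl.
  move=> /cvg_ex[w /fcvgrPdist_lt hw]; exists w; apply: Gclosed => e e0.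
  have [d d0 hd] := hw e e0.
  have [de|/ltW ed] := real_leP (gtr0_real d0) (gtr0_real e0).
    have [u' [w' Gu'] uu'] := Gdense u d d0.
    by exists u', w'; split => //; [exact: lt_le_trans de|exact: hd uu'].
  have [u' [w' Gu'] uu'] := Gdense u e e0.
  by exists u', w'; split => //; apply: hd Gu' _; exact: lt_le_trans ed.
have linT : linear T by move=> c u v; apply: Ginj (hT _) _; exact: GP.
pose T' := HB.pack_for {linear V -> W} T (GRing.isLinear.Build _ _ _ _ T linT).
by exists T'.
Qed.

(** * Hilbert spaces *)

Section HilbertTheory.
Variables (R : realType) (k : scalar_kind) (E : hilbert R k).
Implicit Types (u v w : E).

Lemma inner_herm u v : inner E v u = conj_scalar (inner E u v).
Proof. by rewrite hermC expr0 mul1r. Qed.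

Lemma innerP c u v w : inner E (c *: u + v) w = c * inner E u w + inner E v w.
Proof. by rewrite linearPl. Qed.

Lemma innerPr c u v w :
  inner E w (c *: u + v) = conj_scalar c * inner E w u + inner E w v.
Proof. by rewrite linearPr. Qed.

Lemma innerZ c u w : inner E (c *: u) w = c * inner E u w.
Proof. by rewrite linearZl_LR. Qed.

Lemma innerZr c u w : inner E w (c *: u) = conj_scalar c * inner E w u.
Proof. by rewrite linearZr_LR. Qed.

Lemma innerB u v w : inner E (u - v) w = inner E u w - inner E v w.
Proof. by rewrite linearBl. Qed.

Lemma innerBr u v w : inner E w (u - v) = inner E w u - inner E w v.
Proof. by rewrite linearBr. Qed.

Lemma inner_cauchy_schwarz u v : `|inner E u v| <= `|u| * `|v|.
Proof.
rewrite -(@ler_pXn2r _ 2) ?nnegrE ?mulr_ge0//.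
rewrite exprMn -!innerxx; apply: cauchy_schwarz_scalar.
  by rewrite innerxx exprn_ge0.
move=> t; have : 0 <= inner E (- t *: v + u) (- t *: v + u).
  by rewrite innerxx exprn_ge0.
rewrite innerP !innerPr (inner_herm u v) rmorphN/=.
rewrite mulrDr addrA !mulNr !mulrN opprK mulrA; congr (0 <= _).
by rewrite [LHS]addrC [X in _ + X = _]addrC [X in _ + (_ + X) = _]addrC !addrA.
Qed.

Lemma inner_dense_inj (D : set E) u v : norm_dense D ->
  (forall d, D d -> inner E u d = inner E v d) -> u = v.
Proof.
move=> hD uv; apply/subr0_eq/normr0_eq0/eqP; rewrite -sqrf_eq0 -innerxx;
  apply/eqP.
apply: (@eq_scalar_approx _ _ _ `|u - v|) => [//|e /andP[e0 _]].
have [d Dd hd] := hD (u - v) e e0.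
have -> : inner E (u - v) (u - v) - 0 = inner E (u - v) (u - v - d).
  by rewrite subr0 (innerBr _ d) (innerB _ _ d) uv// subrr subr0.
by rewrite (le_trans (inner_cauchy_schwarz _ _))// ler_wpM2l// ltW.
Qed.

Lemma inner_span_eq (A : set E) u v :
  (forall a, A a -> inner E u a = inner E v a) ->
  forall d, lin_span A d -> inner E u d = inner E v d.
Proof.
move=> uv d; elim/lin_span_ind => [|c a w Aa _ IHw]; first by rewrite !linear0r.
by rewrite !innerPr IHw uv.
Qed.

Lemma inner_span_inj (A : set E) u v : norm_dense (lin_span A) ->
  (forall a, A a -> inner E u a = inner E v a) -> u = v.
Proof. by move=> /inner_dense_inj uv /inner_span_eq /uv. Qed.

End HilbertTheory.

(** * Operators between Hilbert spaces *)

Lemma bounded_op_bound (R : realType) (k : scalar_kind) (E F : hilbert R k)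
    (T : bounded_op E F) :
  exists2 C, 0 <= C & forall u, `|T u| <= C * `|u|.
Proof.
have /linear_boundedP h := bounded_opP T.
have [C [hC C0]] : exists C, (forall u, `|T u| <= C * `|u|) /\ 0 < C.
  apply: (@filter_ex _ (pinfty_nbhs (scalars R k))).
  by apply: filterI => //; exact: nbhs_pinfty_gt.
by exists C => //; exact: ltW.
Qed.

Lemma bounded_op_of_bound (R : realType) (k : scalar_kind) (E F : hilbert R k)
    (T : {linear E -> F}) C : 0 <= C -> (forall u, `|T u| <= C * `|u|) ->
  bounded_near T (nbhs (0 : E)).
Proof.
move=> C0 hC; apply/linear_boundedP.
exists C; split; first exact: ger0_real.
by move=> r Cr u; rewrite (le_trans (hC u))// ler_wpM2r// ltW.
Qed.

(** An adjoint on a dense set extends to an adjoint everywhere: the relation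
    defining it is closed, and its values are bounded because
    |w|^2 = <V w, v>. *)
Lemma adjoint_of_dense (R : realType) (k : scalar_kind) (E F : hilbert R k)
    (V : bounded_op E F) :
  norm_dense [set v | exists w, forall h, inner F (V h) v = inner E h w] ->
  exists W : bounded_op F E, is_adjoint V W.
Proof.
move=> hD; have [C C0 hC] := bounded_op_bound V.
pose G v w := forall h, inner F (V h) v = inner E h w.
have Gbound v w : G v w -> `|w| <= C * `|v|.
  move=> Gvw; have : `|w| ^+ 2 <= `|w| * (C * `|v|).
    rewrite -innerxx -Gvw -[leLHS]ger0_norm ?Gvw ?innerxx ?exprn_ge0// -innerxx
      -Gvw.
    by rewrite (le_trans (inner_cauchy_schwarz _ _))// mulrA [_ * C]mulrC
      ler_wpM2r.
  have := normr_ge0 w; rewrite le_eqVlt => /predU1P[<- _|w0].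
    by rewrite mulr_ge0.
  by rewrite expr2 ler_pM2l.
have [||W hW] := @closed_relation_operator _ F E G C C0 _ Gbound _ hD.
- by move=> c v w v' w' h h' x; rewrite !innerPr h h'.
- move=> v w hvw h; apply: (@eq_scalar_approx _ _ _ (`|V h| + `|h|)).
    exact: addr_ge0.
  move=> e /andP[e0 _]; have [v' [w' [hG vv' ww']]] := hvw e e0.
  rewrite (le_trans (ler_distD (inner E h w') _ _))// -{1}hG -innerBr -innerBr.
  rewrite mulrDl lerD// (le_trans (inner_cauchy_schwarz _ _))// ler_wpM2l//
    ltW//.
  by rewrite distrC.
exists (BoundedOp (bounded_op_of_bound C0 (fun v => Gbound _ _ (hW v)))).
by move=> u v; exact: hW.
Qed.

Section SameGram.
Variables (R : realType) (k : scalar_kind) (I : Type).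

Definition same_coord (E F : hilbert R k) (a : I -> E) (b : I -> F) u w :=
  forall i, inner F w (b i) = inner E u (a i).

Lemma same_coord_sym (E F : hilbert R k) (a : I -> E) (b : I -> F) u w :
  same_coord a b u w -> same_coord b a w u.
Proof. by move=> h i. Qed.

Lemma same_coordP (E F : hilbert R k) (a : I -> E) (b : I -> F) c u w u' w' :
  same_coord a b u w -> same_coord a b u' w' ->
  same_coord a b (c *: u + u') (c *: w + w').
Proof. by move=> h h' i; rewrite !innerP h h'. Qed.

Lemma same_coordB (E F : hilbert R k) (a : I -> E) (b : I -> F) u w u' w' :
  same_coord a b u w -> same_coord a b u' w' ->
  same_coord a b (u - u') (w - w').
Proof. by move=> h h' i; rewrite !innerB h h'. Qed.

(** Combinations of a and b with the same coefficients correspond to each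
    other, and have the same inner products with all corresponding vectors. *)
Lemma same_coord_span (E F : hilbert R k) (a : I -> E) (b : I -> F) :
  (forall i j, inner F (b i) (b j) = inner E (a i) (a j)) ->
  forall d, lin_span (range b) d -> exists d0, same_coord a b d0 d /\
    forall u w, same_coord a b u w -> inner F w d = inner E u d0.
Proof.
move=> ab d; elim/lin_span_ind => [|c _ v [i _ <-] _ [v0 [h1 h2]]].
  exists 0; split => [i|u w _]; first by rewrite !linear0l.
  by rewrite !linear0r.
exists (c *: a i + v0); split; first by apply: same_coordP => // j.
by move=> u w h; rewrite !innerPr (h2 _ _ h) h.
Qed.

(** If d in the span of b is close to w, and d0 is the combination of a with the
    same coefficients, then |w|^2 is close to <w, d> = <u, d0>, and |d0| = |d|
    is close to |w|. *)
Lemma same_coord_norm_le (E F : hilbert R k) (a : I -> E) (b : I -> F) :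
  (forall i j, inner F (b i) (b j) = inner E (a i) (a j)) ->
  norm_dense (lin_span (range b)) ->
  forall u w, same_coord a b u w -> `|w| <= `|u|.
Proof.
move=> ab hb u w uw.
have : `|w| ^+ 2 <= `|w| * `|u|.
  apply: (@ler_addmul_gt0 _ _ _ (`|w| + `|u|)); first exact: addr_ge0.
  move=> e /andP[e0 _]; have [d hd wd] := hb w e e0.
  have [d0 [dd0 hd0]] := same_coord_span ab hd.
  have dE : `|d0| = `|d|.
    by apply/eqP; rewrite -(@eqrXn2 _ 2)// -!innerxx (hd0 _ _ dd0).
  rewrite -[_ ^+ 2]ger0_norm ?exprn_ge0// -innerxx.
  rewrite -[inner F w w](subrK (inner F w d)) -innerBr (le_trans (ler_normD _
    _))//.
  rewrite mulrDl addrCA lerD//.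
    by rewrite (le_trans (inner_cauchy_schwarz _ _))// ler_wpM2l// ltW.
  rewrite (hd0 _ _ uw) (le_trans (inner_cauchy_schwarz _ _))// dE.
  rewrite [`|w| * _]mulrC -mulrDr ler_wpM2l//.
  rewrite -[d in leLHS](subrK w) (le_trans (ler_normD _ _))// addrC lerD2l.
  by rewrite distrC ltW.
have := normr_ge0 w; rewrite le_eqVlt => /predU1P[<- //|w0].
by rewrite expr2 ler_pM2l.
Qed.

(** As in the norm estimate, w' is replaced by a combination d of b. The
    corresponding d0 is close to u' by that estimate, applied to the pair
    (w' - d, u' - d0). *)
Lemma same_coord_inner (E F : hilbert R k) (a : I -> E) (b : I -> F) :
  (forall i j, inner F (b i) (b j) = inner E (a i) (a j)) ->
  norm_dense (lin_span (range a)) -> norm_dense (lin_span (range b)) ->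
  forall u w u' w', same_coord a b u w -> same_coord a b u' w' ->
  inner F w w' = inner E u u'.
Proof.
move=> ab ha hb u w u' w' uw uw'.
apply: (@eq_scalar_approx _ _ _ (`|w| + `|u|)) => [|e /andP[e0 _]].
  exact: addr_ge0.
have [d hd wd] := hb w' e e0; have [d0 [dd0 hd0]] := same_coord_span ab hd.
have ba i j : inner E (a i) (a j) = inner F (b i) (b j) by rewrite ab.
have := same_coord_norm_le ba ha (same_coord_sym (same_coordB uw' dd0)).
move=> /le_lt_trans/(_ wd) ud.
rewrite (le_trans (ler_distD (inner F w d) _ _))// -innerBr (hd0 _ _ uw).
rewrite -innerBr mulrDl lerD// (le_trans (inner_cauchy_schwarz _ _))//.
  by rewrite ler_wpM2l// ltW.
by rewrite distrC ler_wpM2l// ltW.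
Qed.

Lemma same_coord_operator (E F : hilbert R k) (a : I -> E) (b : I -> F) :
  (forall i j, inner F (b i) (b j) = inner E (a i) (a j)) ->
  norm_dense (lin_span (range a)) -> norm_dense (lin_span (range b)) ->
  exists U : {linear E -> F}, forall u, same_coord a b u (U u).
Proof.
move=> ab ha hb.
have ba i j : inner E (a i) (a j) = inner F (b i) (b j) by rewrite ab.
apply: (@closed_relation_operator _ E F (same_coord a b) 1) => //.
- by move=> c u w u' w'; exact: same_coordP.
- by move=> u w uw; rewrite mul1r (same_coord_norm_le ab hb uw).
- move=> u w huw i; apply: (@eq_scalar_approx _ _ _ (`|b i| + `|a i|)).
    exact: addr_ge0.
  move=> e /andP[e0 _]; have [u' [w' [hG uu' ww']]] := huw e e0.
  rewrite (le_trans (ler_distD (inner F w' (b i)) _ _))// {2}hG -!innerB.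
  rewrite mulrDl lerD// (le_trans (inner_cauchy_schwarz _ _))// mulrC
    ler_wpM2l//.
    exact: ltW.
  by rewrite distrC ltW.
- move=> u e e0; have [d hd ud] := ha u e e0.
  have [d0 [dd0 _]] := same_coord_span ba hd.
  by exists d => //; exists d0; exact: same_coord_sym.
Qed.

(** The correspondence of vectors with the same coordinates is a closed
    isometric relation in both directions, hence the graph of a unitary
    operator. *)
Lemma same_gram_unitary (E F : hilbert R k) (a : I -> E) (b : I -> F) :
  (forall i j, inner F (b i) (b j) = inner E (a i) (a j)) ->
  norm_dense (lin_span (range a)) -> norm_dense (lin_span (range b)) ->
  exists2 U : {linear E -> F}, unitary U & forall i, U (a i) = b i.
Proof.
move=> ab ha hb.
have ba i j : inner E (a i) (a j) = inner F (b i) (b j) by rewrite ab.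
have [U hU] := same_coord_operator ab ha hb.
have [V hV] := same_coord_operator ba hb ha.
exists U; last first.
  move=> i; apply: (inner_span_inj hb) => _ [j _ <-]; by rewrite hU ab.
split; last by move=> u v; exact: (same_coord_inner ab ha hb).
exists V => u.
  by apply: (inner_span_inj ha) => _ [j _ <-]; rewrite hV hU.
by apply: (inner_span_inj hb) => _ [j _ <-]; rewrite hU hV.
Qed.

End SameGram.

Lemma kernel_vec_dense (R : realType) (k : scalar_kind) (I : Type)
    (K : psd_kernel R k I) : norm_dense (lin_span (range (kernel_vec K))).
Proof.
move=> f e e0; have e20 : 0 < e / 2 by rewrite divr_gt0.
have [p hp] := kspace_approx f e20; exists (kspace_comb K p).
  elim: p {hp} => [|[c i] p IHp].
    have -> : kspace_comb K [::] = 0.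
      by apply/val_inj/funext => j /=; rewrite /kcomb big_nil.
    exact: lin_span0.
  have -> : kspace_comb K ((c, i) :: p) = c *: kernel_vec K i + kspace_comb K p.
    apply/val_inj; rewrite kspace_valP; apply/funext => j /=.
    by rewrite -[RHS]/(c * kcomb K _ j + kcomb K p j) /kcomb big_cons big_seq1
      mul1r.
  by apply: lin_span_cons => //; exists i.
rewrite knormE (@le_lt_trans _ _ (e / 2))//.
  apply: knorm_le_dual_bound; first exact: ltW.
  by rewrite raddfB.
by rewrite ltr_pdivrMr// mulr_natr mulr2n ltrDl.
Qed.

(** * Transport *)

Lemma inner_transport (R : realType) (k : scalar_kind) (E F : hilbert R k)
    (e : E = F) u v : inner F (transport e u) v = inner E u (transport (esym e)
      v).
Proof. by case: F / e v. Qed.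

Lemma transport_trans (R : realType) (k : scalar_kind) (E F Z : hilbert R k)
    (e : E = F) (e' : F = Z) (e'' : E = Z) u :
  transport e' (transport e u) = transport e'' u.
Proof. by case: Z / e' e''; case: F / e => e'';
  rewrite (Prop_irrelevance e'' erefl). Qed.

Lemma transport_irrelevance (R : realType) (k : scalar_kind) (E F : hilbert R k)
    (e e' : E = F) u : transport e u = transport e' u.
Proof. by rewrite (Prop_irrelevance e e'). Qed.

(** * The kernel on each block of the partition *)

Section BlockKernel.
Variables (R : realType) (k : scalar_kind) (G : star_semigroupoid) (X : Type).
Variables (A : left_action G X) (H : X -> hilbert R k).
Local Notation F := (scalars R k).

(** The index set of the scalar kernel of the block X_s. *)
Record block_vec (s : symb G) := BlockVec {
  bpoint : X;
  banchor : anchor A bpoint = s;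
  bvec : H bpoint
}.

Lemma block_vec_eq s x y (e : x = y) (ex : anchor A x = s) (ey : anchor A y = s)
    u v : transport (congr1 H e) u = v -> BlockVec ex u = BlockVec ey v.
Proof.
by case: y / e ey v => ey v /= <-; rewrite (Prop_irrelevance ex ey).
Qed.

Variable K : operator_kernel H.

Definition block_ker s (i j : block_vec s) : F :=
  inner (H (bpoint j)) (K (bpoint j) (bpoint i) (bvec i)) (bvec j).

Hypothesis psdK : partially_psd A K.

Lemma block_ker_herm s (i j : block_vec s) :
  block_ker j i = conj_scalar (block_ker i j).
Proof.
rewrite /block_ker -inner_herm (psdK s).1 ?banchor//.
Qed.

Lemma block_ker_ge0 s (p : seq (F * block_vec s)) :
  0 <= \sum_(x <- p) \sum_(y <- p)
         x.1 * conj_scalar y.1 * block_ker x.2 y.2.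
Proof.
rewrite big_tnth; under eq_bigr do rewrite big_tnth.
set t := tnth _.
have := (psdK s).2 (size p) (fun i => bpoint (t i).2)
  (fun i => (t i).1 *: bvec (t i).2) (fun i => banchor (t i).2).
congr (0 <= _); apply: eq_bigr => i _; apply: eq_bigr => j _.
by rewrite innerZr linearZ/= innerZ mulrCA mulrA.
Qed.

Definition block_psd s : psd_kernel R k (block_vec s) :=
  PsdKernel (@block_ker_herm s) (@block_ker_ge0 s).

Definition block_space s : hilbert R k := kernel_hilbert (block_psd s).

Definition block_feature s (i : block_vec s) : block_space s :=
  kernel_vec (block_psd s) i.

Definition block_dom s : set (block_space s) :=
  lin_span (range (@block_feature s)).

Lemma inner_feature s (i j : block_vec s) :
  inner (block_space s) (block_feature i) (block_feature j) = block_ker i j.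
Proof. exact: inner_kernel_vec. Qed.

Lemma block_dom_dense s : norm_dense (@block_dom s).
Proof. exact: kernel_vec_dense. Qed.

Lemma block_dom_feature s (i : block_vec s) : block_dom (block_feature i).
Proof. by apply: lin_span_mem; exists i. Qed.

Lemma feature_inj s (u v : block_space s) :
  (forall j, inner _ u (block_feature j) = inner _ v (block_feature j)) -> u =
    v.
Proof.
by move=> uv; apply: (inner_span_inj (@block_dom_dense s)) => _ [j _ <-].
Qed.

Lemma btransport_feature s t (e : s = t) (i : block_vec s) :
  btransport e (block_feature i) =
  block_feature (BlockVec (etrans (banchor i) e) (bvec i)).
Proof. by case: t / e; case: i. Qed.

(** ** The operators V_x *)

Definition point_feature x (h : H x) : block_space (anchor A x) :=
  block_feature (BlockVec erefl h).

Lemma point_feature_linear x : linear (@point_feature x).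
Proof.
move=> c h h'; apply: feature_inj => j.
rewrite innerP !inner_feature /block_ker/=.
by rewrite linearP innerP.
Qed.

HB.instance Definition _ x := GRing.isLinear.Build F (H x)
  (block_space (anchor A x)) _ (@point_feature x) (@point_feature_linear x).

Lemma point_feature_bounded x :
  bounded_near (@point_feature x) (nbhs (0 : H x)).
Proof.
have [C C0 hC] := bounded_op_bound (K x x).
apply: (@bounded_op_of_bound _ _ _ _ (@point_feature x) (sqrt_scalar C)).
  exact: sqrt_scalar_ge0.
move=> h; set v : block_space _ := point_feature h;
  change (`|v| <= sqrt_scalar C * `|h|).
rewrite -(@ler_pXn2r _ 2) ?nnegrE ?mulr_ge0 ?sqrt_scalar_ge0//.
have hE : `|v| ^+ 2 = inner (H x) (K x x h) h by rewrite -innerxx inner_feature.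
rewrite exprMn (sqr_sqrt_scalar C0) -[leLHS]ger0_norm ?exprn_ge0// hE.
rewrite (le_trans (inner_cauchy_schwarz _ _))//=.
by rewrite expr2 mulrA ler_wpM2r.
Qed.

Definition point_op x : bounded_op (H x) (block_space (anchor A x)) :=
  BoundedOp (@point_feature_bounded x).

Lemma inner_r_inj (E : hilbert R k) (v w : E) :
  (forall u, inner E u v = inner E u w) -> v = w.
Proof.
move=> vw; apply/subr0_eq/normr0_eq0/eqP; rewrite -sqrf_eq0 -innerxx innerBr.
by rewrite vw subrr.
Qed.

Lemma point_op_adjoint x :
  exists W : bounded_op (block_space (anchor A x)) (H x),
    is_adjoint (point_op x) W.
Proof.
apply: adjoint_of_dense => u e e0; have [d hd ud] := block_dom_dense u e0.
exists d => //; elim/lin_span_ind : hd => [|c _ v [j _ <-] _ [w hw]].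
  by exists 0 => h; rewrite !linear0r.
exists (c *: K x (bpoint j) (bvec j) + w) => h.
rewrite !innerPr hw inner_feature /block_ker/=.
by rewrite (psdK (anchor A x)).1 ?banchor.
Qed.

Lemma point_op_kernel x y (e : anchor A y = anchor A x) :
  exists W : bounded_op (block_space (anchor A x)) (H x),
    is_adjoint (point_op x) W /\
    forall h : H y, K x y h = W (btransport e (point_op y h)).
Proof.
have [W hW] := point_op_adjoint x; exists W; split => // h.
apply: inner_r_inj => u; rewrite -hW btransport_feature inner_feature
  /block_ker/=.
by rewrite (psdK (anchor A x)).1.
Qed.

(** ** The operators Psi(g) *)

Variable eH : invariant_bundle A H.
Hypothesis invK : invariant_kernel eH K.

(** The endpoints of an arrow g are allowed to be known only up to equality;
    this spares casts between the spaces of equal symbols. *)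
Definition block_act g s t (p : dom g = s) (q : cod g = t) (i : block_vec s) :
    block_vec t :=
  let r := etrans p (esym (banchor i)) in
  BlockVec (etrans (anchor_act r) q) (transport (esym (eH r)) (bvec i)).

(** Invariance of the kernel moves g from the first argument of K to the second;
    the Hermitian symmetry before and after brings this to the scalar kernel. *)
Lemma block_act_adj g s t (p : dom g = s) (q : cod g = t)
    (p' : dom (star g) = t) (q' : cod (star g) = s) i j :
  block_ker (block_act p q i) j = block_ker i (block_act p' q' j).
Proof.
case: i j => x ex h [y ey h'].
case: s / ex p q' => p q'; case: t / ey q p' => q p';
  rewrite /block_act /block_ker/=.
have := invK p q; set r := etrans (dom_star g) q; move=> hr.
rewrite (Prop_irrelevance p' r).
rewrite (psdK (anchor A y)).1 ?anchor_act ?q// inner_transport.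
rewrite (transport_irrelevance _ (eH p)) hr.
by rewrite (psdK (anchor A x)).1// anchor_act.
Qed.

Lemma block_act_mul g h s t (p : dom g = cod h) r
    (p1 : dom (sgd_mul p) = s) (q1 : cod (sgd_mul p) = t)
    (p2 : dom g = r) (q2 : cod g = t) (p3 : dom h = s) (q3 : cod h = r) i :
  block_act p1 q1 i = block_act p2 q2 (block_act p3 q3 i).
Proof.
case: i => x ex u; rewrite /block_act/=.
set r1 := etrans p1 _; set r3 := etrans p3 _; set r2 := etrans p2 _.
have e : act r1 = act r2.
  rewrite (Prop_irrelevance r1 (etrans (dom_mul p) r3)) act_mul.
  by rewrite (Prop_irrelevance r2 (etrans p (esym (anchor_act r3)))).
apply: (block_vec_eq (e := e)).
by rewrite !(transport_trans _ _ (etrans (esym (eH r1)) (congr1 H e))).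
Qed.

(** Prescribing the coordinates of the image, instead of its expansion in the
    vectors [block_feature], makes the operator well defined without comparing
    the expansions of one vector. *)
Definition block_op g s t (p : dom g = s) (q : cod g = t) (u : block_space s) :
    block_space t :=
  xget 0 [set w | block_dom w /\ forall j,
    inner _ w (block_feature j) =
    inner _ u (block_feature
      (block_act (etrans (dom_star g) q) (etrans (cod_star g) p) j))].

Section BlockOp.
Variables (g : G) (s t : symb G) (p : dom g = s) (q : cod g = t).
Variables (p' : dom (star g) = t) (q' : cod (star g) = s).

(** For a combination of vectors e_i, the combination of the e_(g i) with the
    same coefficients has the prescribed coordinates, by invariance. *)
Lemma block_op_prop u : block_dom u -> block_dom (block_op p q u) /\
  forall j, inner _ (block_op p q u) (block_feature j) =
            inner _ u (block_feature (block_act p' q' j)).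
Proof.
rewrite (Prop_irrelevance p' (etrans (dom_star g) q)).
rewrite (Prop_irrelevance q' (etrans (cod_star g) p)).
move=> hu; rewrite /block_op; set P := (X in xget _ X).
suff : exists w, P w by exact: xgetPex.
rewrite {}/P; elim/lin_span_ind : hu => [|c _ v [i _ <-] _ [w [hw1 hw2]]].
  exists 0; split; first exact: lin_span0.
  by move=> j; rewrite !linear0l.
exists (c *: block_feature (block_act p q i) + w); split.
  by apply: lin_span_cons hw1; exists (block_act p q i).
move=> j; rewrite !innerP hw2 !inner_feature; congr (_ * _ + _).
exact: block_act_adj.
Qed.

Lemma block_op_unique u w : block_dom u ->
  (forall j, inner _ w (block_feature j) =
             inner _ u (block_feature (block_act p' q' j))) ->
  block_op p q u = w.
Proof.
move=> hu hw; apply: feature_inj => j.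
by rewrite (block_op_prop hu).2 hw.
Qed.

End BlockOp.

Lemma block_op_dom g s t (p : dom g = s) (q : cod g = t) u :
  block_dom u -> block_dom (block_op p q u).
Proof.
by move=> /(block_op_prop p q (etrans (dom_star g) q) (etrans (cod_star g)
  p))[].
Qed.

Lemma block_op_feature g s t (p : dom g = s) (q : cod g = t) i :
  block_op p q (block_feature i) = block_feature (block_act p q i).
Proof.
apply: (@block_op_unique _ _ _ p q (etrans (dom_star g) q) (etrans (cod_star g)
  p)).
  exact: block_dom_feature.
by move=> j; rewrite !inner_feature; exact: block_act_adj.
Qed.

Lemma block_op_linear g s t (p : dom g = s) (q : cod g = t) c u v :
  block_dom u -> block_dom v ->
  block_op p q (c *: u + v) = c *: block_op p q u + block_op p q v.
Proof.
move=> hu hv; pose p' := etrans (dom_star g) q;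
  pose q' := etrans (cod_star g) p.
apply: (@block_op_unique _ _ _ p q p' q'); first exact: (lin_span_subspace _).2.
move=> j; rewrite !innerP.
by rewrite (block_op_prop p q p' q' hu).2 (block_op_prop p q p' q' hv).2.
Qed.

Lemma block_op0 g s t (p : dom g = s) (q : cod g = t) : block_op p q 0 = 0.
Proof.
apply: (@block_op_unique _ _ _ p q (etrans (dom_star g) q) (etrans (cod_star g)
  p)).
  exact: lin_span0.
by move=> j; rewrite !linear0l.
Qed.

Lemma block_op_adj g s t (p : dom g = s) (q : cod g = t)
    (p' : dom (star g) = t) (q' : cod (star g) = s) u w :
  block_dom u -> block_dom w ->
  inner _ (block_op p q u) w = inner _ u (block_op p' q' w).
Proof.
move=> hu; elim/lin_span_ind => [|c _ v [j _ <-] hv IHv].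
  by rewrite block_op0 !linear0r.
rewrite block_op_linear//; last exact: block_dom_feature.
rewrite !innerPr IHv block_op_feature; congr (_ * _ + _).
exact: (block_op_prop p q p' q' hu).2.
Qed.

Lemma block_op_mul g h s t (p : dom g = cod h) r
    (p1 : dom (sgd_mul p) = s) (q1 : cod (sgd_mul p) = t)
    (p2 : dom g = r) (q2 : cod g = t) (p3 : dom h = s) (q3 : cod h = r) v :
  block_dom v ->
  block_op p1 q1 v = block_op p2 q2 (block_op p3 q3 v).
Proof.
elim/lin_span_ind => [|c _ w [i _ <-] hw IHw]; first by rewrite !block_op0.
have hi := block_dom_feature i.
rewrite (block_op_linear p1 q1 c hi hw) (block_op_linear p3 q3 c hi hw).
rewrite block_op_linear ?IHw ?block_op_feature//; first last.
- exact: block_op_dom.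
- exact: block_dom_feature.
by rewrite -(block_act_mul p1 q1).
Qed.

Lemma block_op_btransport g s s' t (e : s' = s) (p : dom g = s) (q : cod g = t)
  u :
  block_op p q (btransport e u) = block_op (etrans p (esym e)) q u.
Proof. by case: s / e p. Qed.

Lemma btransport_block_op g s t t' (e : t = t') (p : dom g = s) (q : cod g = t)
  u :
  btransport e (block_op p q u) = block_op p (etrans q e) u.
Proof. by case: t' / e. Qed.

Lemma block_op_adj_dom g (w : block_space (cod g)) : block_dom w ->
  exists z, adjoint_graph (@block_dom (dom g)) (block_op erefl erefl) w z.
Proof.
move=> hw; exists (block_op (dom_star g) (cod_star g) w) => u hu.
exact: block_op_adj.
Qed.

(** By density of the domain, z is the value at w of the operator of g*. *)
Lemma block_op_adj_maps g (w : block_space (cod g)) z : block_dom w ->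
  adjoint_graph (@block_dom (dom g)) (block_op erefl erefl) w z -> block_dom z.
Proof.
move=> hw wz; have <- : block_op (dom_star g) (cod_star g) w = z.
  apply: (inner_dense_inj (@block_dom_dense _)) => d hd.
  rewrite (inner_herm d) (inner_herm d z); congr (conj_scalar _).
  by rewrite -wz// -(block_op_adj erefl erefl).
exact: block_op_dom.
Qed.

Definition block_rep g : Lstar (@block_dom (dom g)) (@block_dom (cod g)) :=
  LStar (@block_op_linear g _ _ erefl erefl) (@block_op_dom g _ _ erefl erefl)
    (@block_op_adj_dom g) (@block_op_adj_maps g).

Lemma block_rep_mul g h (p : dom g = cod h) (v : block_space (dom h)) :
  block_dom v ->
  btransport (cod_mul p)
    (block_rep (sgd_mul p) (btransport (esym (dom_mul p)) v)) =
  block_rep g (btransport (esym p) (block_rep h v)).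
Proof.
move=> hv; rewrite /= !block_op_btransport !btransport_block_op.
exact: block_op_mul.
Qed.

Lemma block_rep_star g (w : block_space (cod g)) : block_dom w ->
  adjoint_graph (@block_dom (dom g)) (block_rep g) w
    (btransport (cod_star g)
      (block_rep (star g) (btransport (esym (dom_star g)) w))).
Proof.
move=> hw u hu; rewrite /= block_op_btransport btransport_block_op.
exact: block_op_adj.
Qed.

Lemma block_rep_point g x (p : dom g = anchor A x) (h : H x) :
  block_rep g (btransport (esym p) (point_op x h)) =
  btransport (anchor_act p) (point_op (act p) (transport (esym (eH p)) h)).
Proof.
rewrite /= block_op_btransport block_op_feature btransport_feature.
congr block_feature; rewrite /block_act/=.
set r := etrans _ _; rewrite (Prop_irrelevance r p).
by congr BlockVec; exact: Prop_irrelevance.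
Qed.

Definition block_linearisation : linearisation eH K :=
  @Linearisation R k G X A H eH K block_space block_dom point_op block_rep
    (fun s => lin_span_subspace _)
    (fun s => norm_dense_dense (@block_dom_dense s))
    point_op_kernel block_rep_mul block_rep_star
    (fun _ x _ h => block_dom_feature _) block_rep_point.

End BlockKernel.

(** * Uniqueness *)

Section LinearisationFeature.
Variables (R : realType) (k : scalar_kind) (G : star_semigroupoid) (X : Type).
Variables (A : left_action G X) (H : X -> hilbert R k).
Variables (eH : invariant_bundle A H) (K : operator_kernel H).
Variable L : linearisation eH K.

Definition lin_feature s (i : block_vec A H s) : lspace L s :=
  btransport (banchor i) (lV L (bpoint i) (bvec i)).

Lemma lV_range_feature s : lV_range L s = range (@lin_feature s).
Proof.
apply/seteqP; split => [_ [x [e [h ->]]]|_ [[x e h] _ <-]].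
  by exists (BlockVec e h).
by exists x, e, h.
Qed.

Lemma inner_lin_feature s (i j : block_vec A H s) :
  inner (lspace L s) (lin_feature i) (lin_feature j) = block_ker K i j.
Proof.
case: i j => x ex h [y ey h']; case: s / ey ex => ex.
have [W [hW hK]] := lV_kernel L ex.
by rewrite /block_ker/= hK inner_herm [RHS]inner_herm hW.
Qed.

Lemma lPsi_feature g (i : block_vec A H (dom g)) :
  lPsi L g (lin_feature i) = lin_feature (block_act eH erefl erefl i).
Proof.
case: i => x ex h; rewrite /block_act/=; set r := etrans _ _.
have := lPsi_V L r h; rewrite /lin_feature/=.
by rewrite (Prop_irrelevance (esym r) ex).
Qed.

End LinearisationFeature.

Theorem theorem3p10 (R : realType) (k : scalar_kind)
    (G : star_semigroupoid) (X : Type) (A : left_action G X)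
    (H : X -> hilbert R k) (eH : invariant_bundle A H) (K : operator_kernel H) :
  invariant_kernel eH K -> partially_psd A K ->
  exists L : linearisation eH K,
    minimal L /\
    forall L' : linearisation eH K,
      minimal L' ->
      (forall s : symb G, ldom L' s = lin_span (lV_range L' s)) ->
      exists U : forall s : symb G, {linear lspace L s -> lspace L' s},
        [/\ forall s, unitary (U s),
            forall s (v : lspace L s), ldom L s v -> ldom L' s (U s v),
            forall (g : G) (v : lspace L (dom g)), ldom L (dom g) v ->
              U (cod g) (lPsi L g v) = lPsi L' g (U (dom g) v)
          & forall (x : X) (h : H x), U (anchor A x) (lV L x h) = lV L' x h].
Proof.
move=> invK psdK; pose L := block_linearisation psdK invK.
have featureE s (i : block_vec A H s) : lin_feature L i = block_feature psdK i.
  by case: i => x e h; case: s / e.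
have rangeE s : lV_range L s = range (@block_feature _ _ _ _ _ _ _ psdK s).
  by rewrite lV_range_feature; congr (image _ _); apply/funext => i;
    exact: featureE.
exists L; split.
  by move=> s; rewrite rangeE; apply/closureT_norm_dense/block_dom_dense.
move=> L' minL' domL'.
have exU : forall s, exists U : {linear lspace L s -> lspace L' s},
    unitary U /\ forall i, U (block_feature psdK i) = lin_feature L' i.
  move=> s; have [|||U U1 U2] := @same_gram_unitary _ _ _ (lspace L s)
      (lspace L' s) (@block_feature _ _ _ _ _ _ _ psdK s) (@lin_feature _ _ _ _
        _ _ _ _ L' s).
  - by move=> i j; rewrite inner_lin_feature [RHS]inner_feature.
  - exact: block_dom_dense.
  - rewrite -lV_range_feature; apply/closureT_norm_dense/minL'.
  by exists U.
pose U s := sval (cid (exU s)).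
have hU s : unitary (U s) /\ forall i, U s (block_feature psdK i) = lin_feature
  L' i.
  exact: svalP (cid (exU s)).
have dom_feature s (i : block_vec A H s) : ldom L' s (lin_feature L' i).
  by rewrite domL' lV_range_feature; apply: lin_span_mem; exists i.
have domU s v : ldom L s v -> ldom L' s (U s v).
  elim/lin_span_ind => [|c _ w [i _ <-] _ IHw].
    by rewrite linear0; exact: (ldom_subspace L' s).1.
  by rewrite linearP (hU s).2; apply: (ldom_subspace L' s).2.
exists U; split => //.
- by move=> s; exact: (hU s).1.
- move=> g v; elim/lin_span_ind => [|c _ w [i _ <-] hw IHw].
    have h0 := (ldom_subspace L' (dom g)).1.
    have -> : lPsi L g 0 = 0 by exact: block_op0.
    rewrite !linear0.
    have := Lstar_linear (lPsi L' g) (-1) h0 h0.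
    by rewrite scaleN1r addNr scaleN1r addNr.
  have -> : lPsi L g (c *: block_feature psdK i + w) =
      c *: lPsi L g (block_feature psdK i) + lPsi L g w.
    by apply: (Lstar_linear (lPsi L g)) => //; exact: block_dom_feature.
  rewrite !linearP (Lstar_linear (lPsi L' g))//; last first.
  + exact: domU.
  + by rewrite (hU _).2; exact: dom_feature.
  rewrite -IHw (hU (dom g)).2 lPsi_feature.
  have -> : lPsi L g (block_feature psdK i) =
      block_feature psdK (block_act eH erefl erefl i) by exact:
        block_op_feature.
  by rewrite (hU (cod g)).2.
- move=> x h; exact: (hU (anchor A x)).2 (BlockVec erefl h).
Qed.
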